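(* Let $A$ be an algebra without nonzero oriented cycles, with ordinary quiver $Q$ (so $A=\Bbbk Q/I$ with $I$ an admissible ideal). Let $\phi$ and $\psi$ be automorphisms of $\hat{A}$ with jump $n\in\mathbb{Z}$ that coincide on the objects of $\hat{A}$, and let $\mathcal{S}$ be a complete set of representatives of equivalence classes of simple cycles in $Q$. Assume that (1) for each $x,y\in Q_0$ and each $\alpha\in Q_1(x,y)$, there exists some $c_{x,y}\in\Bbbk^{\times}$ such that $(\phi_0^{-1}\psi_0)(\overline{\alpha})=c_{x,y}\overline{\alpha}$; and (2) for each cycle $C=l_m\cdots l_1$ $(l_1,\dots,l_m\in\overline{Q}_1)$ in $\mathcal{S}$, we have $(\phi_0^{-1}\psi_0)_C=1$, where $(\phi_0^{-1}\psi_0)_C:=(\phi_0^{-1}\psi_0)_{l_m}\cdots(\phi_0^{-1}\psi_0)_{l_1}$ with $(\phi_0^{-1}\psi_0)_{\alpha}:=c_{s(\alpha),t(\alpha)}$ and $(\phi_0^{-1}\psi_0)_{\alpha^{-1}}:=(c_{s(\alpha),t(\alpha)})^{-1}$ for $\alpha\in Q_1$. Then $(\mathrm{id}_{\hat{A}},\eta)/\mathbb{Z}\colon\hat{A}/\langle\phi\rangle\to\hat{A}/\langle\psi\rangle$ is an equivalence in $\mathbb{Z}\text{-}\mathbf{GrCat}$ for some natural isomorphism $\eta\colon\psi\Rightarrow\phi$; in particular, it is an isomorphism of $\mathbb{Z}$-graded categories when $n\neq0$.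
   Context: Conventions. $\Bbbk$ is an algebraically closed field, $D=\operatorname{Hom}_{\Bbbk}(-,\Bbbk)$; all categories and functors are $\Bbbk$-linear. All algebras are basic, connected, nonzero, finite-dimensional $\Bbbk$-algebras. An algebra $A$ is identified with the category with object set $A_0$, a fixed complete set of orthogonal primitive idempotents of $A$, with $A(x,y)=yAx$ and composition given by multiplication; $Q_0=A_0$. Automorphisms of a category are ($\Bbbk$-linear) isomorphisms of the category onto itself. $A$ has no nonzero oriented cycles if $A(x,x)=\Bbbk$ for all $x\in A_0$. For $\alpha\in Q_1$, $\overline{\alpha}:=\alpha+I$; $Q_1(x,y)$ is the set of arrows with source $x$ and target $y$. Walks and cycles. The double quiver $\overline{Q}$ of $Q$ has vertices $Q_0$ and arrows $Q_1\sqcup\{a^{-1}\mid a\in Q_1\}$, where $a^{-1}$ has source $t(a)$ and target $s(a)$. A walk in $Q$ is a path in $\overline{Q}$. A walk $C=l_m\cdots l_1$ is a cycle if $s(l_1)=t(l_m)$; it is simple if $s(l_i)\ne s(l_j)$ for all $i\neq j$. For $c\in\{1,\dots,m\}$, $C[c]$ is the cyclic rotation $l_{\overline{m+c}}\cdots l_{\overline{1+c}}$ (indices modulo $m$ in $\{1,\dots,m\}$). Simple cycles $C$, $C'$ are equivalent if they have the same length $m$ and $C[c]=C'$ or $C[c]=C'^{-1}$ for some $c\in\{1,\dots,m\}$. Repetitive category $\hat{A}$. Objects: $x^{[i]}:=(x,i)$ with $x\in A_0$, $i\in\mathbb{Z}$. Morphisms: $\hat{A}(x^{[i]},y^{[i]})=\{f^{[i]}\mid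 f\in A(x,y)\}$, $\hat{A}(x^{[i]},y^{[i+1]})=\{\beta^{[i]}\mid\beta\in D(A(y,x))\}$, all other morphism spaces zero. Composition is that of $A$, or the $A$-bimodule structure of $DA$ ($(\beta f)(u)=\beta(fu)$, $(f\beta)(u)=\beta(uf)$), and zero for two morphisms both raising the index. The Nakayama automorphism $\nu_A$ of $\hat{A}$ raises all indices $[i]$ to $[i+1]$. $A^{[i]}$ is the full subcategory on the objects $x^{[i]}$ $(x\in A_0)$, and $\mathrm{id}^{[i]}\colon A\to A^{[i]}$ is the isomorphism $x\mapsto x^{[i]}$, $f\mapsto f^{[i]}$. An automorphism $\phi$ of $\hat{A}$ has jump $n$ if $\phi(A^{[0]})=A^{[n]}$. For $\phi$ with jump $n$, $\phi_0:=(\mathrm{id}^{[0]})^{-1}\phi\,\nu_A^{-n}\,\mathrm{id}^{[0]}$, an automorphism of $A$. Orbit categories. For a category $\mathcal{C}$ with automorphism $g$, $\mathcal{C}/\langle g\rangle$ is the orbit category of the $\mathbb{Z}$-action $k\mapsto g^k$: it has the objects of $\mathcal{C}$, morphism spaces $\bigoplus_{k\in\mathbb{Z}}\mathcal{C}(g^kx,y)$, composition $(q_l)_l\cdot(f_k)_k=\big(\sum_{l+k=m}q_l\,g^l(f_k)\big)_m$, and is $\mathbb{Z}$-graded with degree-$k$ part $\mathcal{C}(g^kx,y)$. If $\mathcal{C}$ is locally bounded and the action is free on objects (e.g. $\mathcal{C}=\hat{A}$ and $g$ has jump $n\ne0$), one uses the classical orbit category, whose objects are the orbits; it is the full subcategory,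 on a set of orbit representatives (the same set for automorphisms agreeing on objects), of the $\mathbb{Z}$-graded category that has the objects of $\mathcal{C}$, morphism spaces $\bigoplus_{k\in\mathbb{Z}}\mathcal{C}(g^kx,y)$ and composition $(q_l)_l\cdot(f_k)_k=\big(\sum_{l+k=m}q_l\,g^l(f_k)\big)_m$. For automorphisms $g,h$ of $\mathcal{C}$ and a natural isomorphism $\eta\colon h\Rightarrow g$, there is a unique family of natural isomorphisms $\eta_k\colon h^k\Rightarrow g^k$ $(k\in\mathbb{Z})$ with $\eta_1=\eta$ making $(\mathrm{id}_{\mathcal C},(\eta_k)_k)$ a $\mathbb{Z}$-equivariant functor, i.e. $\eta_{k+l}=(\eta_kg^l)\circ(h^k\eta_l)$; $(\mathrm{id}_{\mathcal{C}},\eta)/\mathbb{Z}\colon\mathcal{C}/\langle g\rangle\to\mathcal{C}/\langle h\rangle$ is the functor that is the identity on objects and sends $f\in\mathcal{C}(g^kx,y)$ to $f\circ\eta_{k,x}\in\mathcal{C}(h^kx,y)$. $\mathbb{Z}\text{-}\mathbf{GrCat}$. A degree-preserving functor $\mathcal{B}\to\mathcal{A}$ of $\mathbb{Z}$-graded categories is a pair $(H,r)$ of a functor $H$ and a map $r\colon\mathcal{B}_0\to\mathbb{Z}$ with $H(\mathcal{B}^{r_y+a}(x,y))\subseteq\mathcal{A}^{a+r_x}(Hx,Hy)$ for all $x,y,a$. The 2-category $\mathbb{Z}\text{-}\mathbf{GrCat}$ has small $\mathbb{Z}$-graded categories as objects, degree-preserving functors as 1-morphisms, and as 2-morphisms $(H,r)\to(I,s)$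 the natural transformations $\theta$ with $\theta_x\in\mathcal{A}^{r_x-s_x}(Hx,Ix)$. A degree-preserving functor is an equivalence in it iff it is fully faithful and homogeneously dense (every object $x$ of the target admits a homogeneous isomorphism $x\to H(y)$ for some $y$). An isomorphism of $\mathbb{Z}$-graded categories is a degree-preserving functor that is an isomorphism of categories. *)

(* Defs.v *)
From HB Require Import structures.
From mathcomp Require Import all_boot all_order all_algebra all_field.
From mathcomp Require Import boolp classical_sets functions cardinality fsbigop.

Set Implicit Arguments.
Unset Strict Implicit.
Unset Printing Implicit Defensive.

Import GRing.Theory.
Local Open Scope classical_set_scope.
Local Open Scope ring_scope.

Section DirectSum.
Variables (K : pzRingType) (I : choiceType) (V : I -> lmodType K).

(* the external direct sum of a family of modules *)
Record dsum := Dsum {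
  dcomp :> forall i, V i;
  dsum_finite : finite_set [set i | dcomp i != 0] }.

HB.instance Definition _ := gen_eqMixin dsum.
HB.instance Definition _ := gen_choiceMixin dsum.

Lemma dsumP (f g : dsum) : (forall i, f i = g i) -> f = g.
Proof.
case: f g => [f pf] [g pg] /= e.
have {}e : f = g by apply: functional_extensionality_dep.
by subst g; congr Dsum; apply: Prop_irrelevance.
Qed.

Lemma finite_supp (f : forall i, V i) (s : seq I) :
  (forall i, i \notin s -> f i = 0) -> finite_set [set i | f i != 0].
Proof.
move=> fs; apply: (@sub_finite_set _ _ [set` s]); last exact: finite_seq.
by move=> i /= /eqP; apply: contra_notT => /fs.
Qed.

Lemma dsum_supp (f : dsum) :
  exists2 s : seq I, uniq s & forall i, i \notin s -> f i = 0.
Proof.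
case/finite_seqP: (dsum_finite f) => s sE; exists (undup s).
  exact: undup_uniq.
move=> i; rewrite mem_undup => nis; apply/eqP; apply: contraNT nis => fi.
by have : [set i | f i != 0] i by []; rewrite sE.
Qed.

Lemma dsum0_subproof : finite_set [set i | (0 : V i) != 0].
Proof. by apply: (finite_supp (s := [::])). Qed.
Definition dsum0 := @Dsum (fun i => 0) dsum0_subproof.

Lemma dsumN_subproof (f : dsum) : finite_set [set i | - f i != 0].
Proof.
have [s _ fs] := dsum_supp f.
by apply: (finite_supp (s := s)) => i /fs ->; rewrite oppr0.
Qed.
Definition dsumN (f : dsum) := @Dsum (fun i => - f i) (dsumN_subproof f).

Lemma dsumD_subproof (f g : dsum) : finite_set [set i | f i + g i != 0].
Proof.
have [s _ fs] := dsum_supp f; have [t _ gt] := dsum_supp g.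
apply: (finite_supp (s := s ++ t)) => i.
by rewrite mem_cat negb_or => /andP[/fs -> /gt ->]; rewrite addr0.
Qed.
Definition dsumD (f g : dsum) := @Dsum (fun i => f i + g i) (dsumD_subproof f g).

Lemma dsumZ_subproof a (f : dsum) : finite_set [set i | a *: f i != 0].
Proof.
have [s _ fs] := dsum_supp f.
by apply: (finite_supp (s := s)) => i /fs ->; rewrite scaler0.
Qed.
Definition dsumZ a (f : dsum) := @Dsum (fun i => a *: f i) (dsumZ_subproof a f).

Fact dsum_addA : associative dsumD.
Proof. by move=> f g h; apply: dsumP => i /=; rewrite addrA. Qed.
Fact dsum_addC : commutative dsumD.
Proof. by move=> f g; apply: dsumP => i /=; rewrite addrC. Qed.
Fact dsum_add0 : left_id dsum0 dsumD.
Proof. by move=> f; apply: dsumP => i /=; rewrite add0r. Qed.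
Fact dsum_addN : left_inverse dsum0 dsumN dsumD.
Proof. by move=> f; apply: dsumP => i /=; rewrite addNr. Qed.
HB.instance Definition _ := GRing.isZmodule.Build dsum
  dsum_addA dsum_addC dsum_add0 dsum_addN.

Fact dsum_scaleA a b (v : dsum) : dsumZ a (dsumZ b v) = dsumZ (a * b) v.
Proof. by apply: dsumP => i /=; rewrite scalerA. Qed.
Fact dsum_scale1 : left_id 1 dsumZ.
Proof. by move=> v; apply: dsumP => i /=; rewrite scale1r. Qed.
Fact dsum_scaleDr : right_distributive dsumZ +%R.
Proof. by move=> a v w; apply: dsumP => i /=; rewrite scalerDr. Qed.
Fact dsum_scaleDl (v : dsum) : {morph dsumZ^~ v : a b / a + b}.
Proof. by move=> a b; apply: dsumP => i /=; rewrite scalerDl. Qed.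
HB.instance Definition _ := GRing.Zmodule_isLmodule.Build K dsum
  dsum_scaleA dsum_scale1 dsum_scaleDr dsum_scaleDl.

Lemma dsum0E i : (0 : dsum) i = 0. Proof. by []. Qed.
Lemma dsumNE (f : dsum) i : (- f) i = - f i. Proof. by []. Qed.
Lemma dsumDE (f g : dsum) i : (f + g) i = f i + g i. Proof. by []. Qed.
Lemma dsumZE a (f : dsum) i : (a *: f) i = a *: f i. Proof. by []. Qed.
Lemma dsum_sumE (J : Type) (r : seq J) (F : J -> dsum) i :
  (\sum_(j <- r) F j) i = \sum_(j <- r) F j i.
Proof. by elim/big_rec2: _ => //= j f _ _ ->. Qed.

Definition dinj_fun i (v : V i) j : V j :=
  match i =P j with ReflectT e => ecast z (V z) e v | ReflectF _ => 0 end.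

Lemma dinj_subproof i (v : V i) : finite_set [set j | dinj_fun v j != 0].
Proof.
apply: (finite_supp (s := [:: i])) => j; rewrite inE /dinj_fun.
by case: (i =P j) => // e /eqP []; rewrite e.
Qed.
Definition dinj i (v : V i) : dsum := Dsum (dinj_subproof v).

Lemma dinj_id i (v : V i) : dinj v i = v.
Proof. by rewrite /= /dinj_fun; case: eqP => // e; rewrite eq_axiomK. Qed.
Lemma dinj_ne i (v : V i) j : i != j -> dinj v j = 0.
Proof. by rewrite /= /dinj_fun; case: eqP. Qed.

Lemma dsum_dinjE (f : dsum) (s : seq I) : uniq s ->
  (forall i, i \notin s -> f i = 0) -> f = \sum_(i <- s) dinj (f i).
Proof.
move=> us fs; apply: dsumP => j; rewrite dsum_sumE.
have [js|/[dup] js /fs ->] := boolP (j \in s).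
  rewrite (bigD1_seq j js us) dinj_id big1 => [|i ij]; last by rewrite dinj_ne.
  by rewrite /= addr0.
rewrite big_seq big1 // => i si; rewrite dinj_ne //.
by apply: contraNneq js => <-.
Qed.
End DirectSum.

Lemma fsbigT_seq (V : nmodType) (I : choiceType) (F : I -> V) (s : seq I) :
  uniq s -> (forall i, i \notin s -> F i = 0) ->
  \sum_(i \in [set: I]) F i = \sum_(i <- s) F i.
Proof.
move=> us Fs; rewrite (fsbigE s) //; first by apply: eq_bigl => i; rewrite in_setT.
by move=> i _; apply: Fs.
Qed.

Record lincat (K : fieldType) := LinCat {
  ob :> Type;
  hom : ob -> ob -> lmodType K;
  idm : forall x, hom x x;
  hcomp : forall x y z, hom y z -> hom x y -> hom x z;
  comp_linl : forall x y z (f : hom x y) a (g g' : hom y z),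
    hcomp (a *: g + g') f = a *: hcomp g f + hcomp g' f;
  comp_linr : forall x y z (g : hom y z) a (f f' : hom x y),
    hcomp g (a *: f + f') = a *: hcomp g f + hcomp g f';
  comp1m : forall x y (f : hom x y), hcomp (idm y) f = f;
  compm1 : forall x y (f : hom x y), hcomp f (idm x) = f;
  compA : forall x y z t (h : hom z t) (g : hom y z) (f : hom x y),
    hcomp h (hcomp g f) = hcomp (hcomp h g) f }.

Arguments idm {K} C x : rename.
Arguments hom {K} C x y : rename.
Arguments hcomp {K C x y z} g f : rename.

Reserved Notation "g \@ f" (at level 40, left associativity).
Notation "g \@ f" := (hcomp g f) : ring_scope.

Section CatTheory.
Variables (K : fieldType) (C : lincat K).

Lemma compDl x y z (f : hom C x y) (g g' : hom C y z) :
  (g + g') \@ f = g \@ f + g' \@ f.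
Proof. by have := comp_linl f 1 g g'; rewrite !scale1r. Qed.
Lemma compDr x y z (g : hom C y z) (f f' : hom C x y) :
  g \@ (f + f') = g \@ f + g \@ f'.
Proof. by have := comp_linr g 1 f f'; rewrite !scale1r. Qed.
Lemma comp0m x y z (f : hom C x y) : (0 : hom C y z) \@ f = 0.
Proof.
by have /esym/eqP := compDl f 0 (0 : hom C y z);
  rewrite addr0 -subr_eq0 addrK => /eqP.
Qed.
Lemma compm0 x y z (g : hom C y z) : g \@ (0 : hom C x y) = 0.
Proof.
by have /esym/eqP := compDr g 0 (0 : hom C x y);
  rewrite addr0 -subr_eq0 addrK => /eqP.
Qed.
Lemma compZl x y z (f : hom C x y) a (g : hom C y z) :
  (a *: g) \@ f = a *: (g \@ f).
Proof. by have := comp_linl f a g 0; rewrite comp0m !addr0. Qed.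
Lemma compZr x y z (g : hom C y z) a (f : hom C x y) :
  g \@ (a *: f) = a *: (g \@ f).
Proof. by have := comp_linr g a f 0; rewrite compm0 !addr0. Qed.
Lemma comp_suml x y z (f : hom C x y) J (r : seq J) (F : J -> hom C y z) :
  (\sum_(j <- r) F j) \@ f = \sum_(j <- r) F j \@ f.
Proof. by elim/big_rec2: _ => [|j u v _ <-]; rewrite ?comp0m ?compDl. Qed.
Lemma comp_sumr x y z (g : hom C y z) J (r : seq J) (F : J -> hom C x y) :
  g \@ (\sum_(j <- r) F j) = \sum_(j <- r) g \@ F j.
Proof. by elim/big_rec2: _ => [|j u v _ <-]; rewrite ?compm0 ?compDr. Qed.

(* the identity of x, seen as a morphism x -> y when x = y; it replaces the  *)
(* transport of morphism spaces along equalities of objects *)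
Definition eqm (x y : C) (e : x = y) : hom C x y := ecast z (hom C x z) e (idm C x).

Lemma eqm_id x (e : x = x) : eqm e = idm C x.
Proof. by rewrite (Prop_irrelevance e erefl). Qed.
Lemma eqm_irr x y (e e' : x = y) : eqm e = eqm e'.
Proof. by rewrite (Prop_irrelevance e e'). Qed.
Lemma eqm_comp x y z (e : x = y) (e' : y = z) :
  eqm e' \@ eqm e = eqm (etrans e e').
Proof. by subst z y; rewrite /= comp1m. Qed.

Definition is_iso x y (f : hom C x y) :=
  exists g : hom C y x, g \@ f = idm C x /\ f \@ g = idm C y.
End CatTheory.

Record linfunctor (K : fieldType) (C D : lincat K) := LinFunctor {
  fob :> C -> D;
  fmor : forall x y, hom C x y -> hom D (fob x) (fob y);
  fmor_lin : forall x y a (f g : hom C x y),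
    fmor (a *: f + g) = a *: fmor f + fmor g;
  fmor1 : forall x, fmor (idm C x) = idm D (fob x);
  fmorM : forall x y z (g : hom C y z) (f : hom C x y),
    fmor (g \@ f) = fmor g \@ fmor f }.

Arguments fmor {K C D} F {x y} f : rename.

Section FunctorTheory.
Variable K : fieldType.
Implicit Types C D E : lincat K.

Lemma fmorD C D (F : linfunctor C D) x y (f g : hom C x y) :
  fmor F (f + g) = fmor F f + fmor F g.
Proof. by have := fmor_lin F 1 f g; rewrite !scale1r. Qed.
Lemma fmor0 C D (F : linfunctor C D) x y : fmor F (0 : hom C x y) = 0.
Proof.
by have /esym/eqP := fmorD F 0 (0 : hom C x y);
  rewrite addr0 -subr_eq0 addrK => /eqP.
Qed.
Lemma fmorZ C D (F : linfunctor C D) x y a (f : hom C x y) :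
  fmor F (a *: f) = a *: fmor F f.
Proof. by have := fmor_lin F a f 0; rewrite fmor0 !addr0. Qed.
Lemma fmor_sum C D (F : linfunctor C D) x y J (r : seq J) (f : J -> hom C x y) :
  fmor F (\sum_(j <- r) f j) = \sum_(j <- r) fmor F (f j).
Proof. by elim/big_rec2: _ => [|j u v _ <-]; rewrite ?fmor0 ?fmorD. Qed.
Lemma fmor_eqm C D (F : linfunctor C D) x y (e : x = y) :
  fmor F (eqm e) = eqm (congr1 F e).
Proof. by subst y; rewrite /= fmor1. Qed.

Definition idF C : linfunctor C C :=
  @LinFunctor K C C id (fun _ _ => id) (fun _ _ _ _ _ => erefl)
    (fun _ => erefl) (fun _ _ _ _ _ => erefl).

Section Comp.
Variables (C D E : lincat K) (G : linfunctor D E) (F : linfunctor C D).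
Fact compF_lin x y a (f g : hom C x y) :
  fmor G (fmor F (a *: f + g)) = a *: fmor G (fmor F f) + fmor G (fmor F g).
Proof. by rewrite !fmor_lin. Qed.
Fact compF_id x : fmor G (fmor F (idm C x)) = idm E (G (F x)).
Proof. by rewrite !fmor1. Qed.
Fact compF_comp x y z (g : hom C y z) (f : hom C x y) :
  fmor G (fmor F (g \@ f)) = fmor G (fmor F g) \@ fmor G (fmor F f).
Proof. by rewrite !fmorM. Qed.
Definition compF : linfunctor C E := @LinFunctor K C E (fun x => G (F x))
  (fun x y f => fmor G (fmor F f)) compF_lin compF_id compF_comp.
End Comp.

Lemma linfunctorP C D (F G : linfunctor C D) (e : forall x, F x = G x) :
  (forall x y (f : hom C x y), eqm (e y) \@ fmor F f = fmor G f \@ eqm (e x)) ->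
  F = G.
Proof.
case: F G e => [F f lf i c] [G g lg i' c'] /= e H.
have eFG : F = G by apply: functional_extensionality_dep.
subst G.
have eq_fg : f = g.
  apply: functional_extensionality_dep => x.
  apply: functional_extensionality_dep => y.
  apply: functional_extensionality_dep => u.
  by have := H x y u; rewrite !eqm_id comp1m compm1.
by subst g; congr LinFunctor; apply: Prop_irrelevance.
Qed.

Lemma linfunctor_congr C D (F G : linfunctor C D) (e : F = G) x y (f : hom C x y) :
  eqm (congr1 (fun H : linfunctor C D => H y) e) \@ fmor F f =
  fmor G f \@ eqm (congr1 (fun H : linfunctor C D => H x) e).
Proof. by subst G; rewrite !eqm_id comp1m compm1. Qed.

Lemma compFA C D E B (H : linfunctor E B) (G : linfunctor D E) (F : linfunctor C D) :
  compF H (compF G F) = compF (compF H G) F.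
Proof.
apply: (@linfunctorP _ _ (compF H (compF G F)) (compF (compF H G) F) (fun=> erefl)) => x y f.
by rewrite !eqm_id comp1m compm1.
Qed.
Lemma compF1 C D (F : linfunctor C D) : compF F (idF C) = F.
Proof.
apply: (@linfunctorP _ _ (compF F (idF C)) F (fun=> erefl)) => x y f.
by rewrite !eqm_id comp1m compm1.
Qed.
Lemma comp1F C D (F : linfunctor C D) : compF (idF D) F = F.
Proof.
apply: (@linfunctorP _ _ (compF (idF D) F) F (fun=> erefl)) => x y f.
by rewrite !eqm_id comp1m compm1.
Qed.
End FunctorTheory.

Record nattrans (K : fieldType) (C D : lincat K) (F G : linfunctor C D) := NatTrans {
  ntc :> forall x, hom D (F x) (G x);
  ntcP : forall x y (f : hom C x y), ntc y \@ fmor F f = fmor G f \@ ntc x }.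

Definition is_natiso (K : fieldType) (C D : lincat K) (F G : linfunctor C D)
    (eta : nattrans F G) := forall x, is_iso (eta x).

(* Equality of functors is Leibniz equality, see [linfunctorP]. *)
Record autom (K : fieldType) (C : lincat K) := Autom {
  autf :> linfunctor C C;
  autinv : linfunctor C C;
  autK : compF autinv autf = idF C;
  autKV : compF autf autinv = idF C }.

Definition aut_inv (K : fieldType) (C : lincat K) (g : autom C) : autom C :=
  Autom (autKV g) (autK g).

Section Powers.
Variables (K : fieldType) (C : lincat K) (g : autom C).

Fact aut_comp_subproof (h : autom C) :
  compF (compF (autinv h) (autinv g)) (compF g h) = idF C.
Proof. by rewrite compFA -(compFA (autinv h)) autK compF1 autK. Qed.
Fact aut_comp_subproofV (h : autom C) :
  compF (compF g h) (compF (autinv h) (autinv g)) = idF C.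
Proof. by rewrite compFA -(compFA g) autKV compF1 autKV. Qed.

Definition aut_comp (h : autom C) : autom C :=
  Autom (aut_comp_subproof h) (aut_comp_subproofV h).

Definition apow (i : int) : linfunctor C C :=
  match i with
  | Posz m => iter m (compF g) (idF C)
  | Negz m => iter m.+1 (compF (autinv g)) (idF C)
  end.

Lemma apowS i : apow (1 + i) = compF g (apow i).
Proof.
case: i => [m|[|m]] //; first by rewrite /= compF1 autKV.
have -> : 1 + Negz m.+1 = Negz m.
  by rewrite !NegzE -[m.+2]addn1 PoszD opprD addrCA subrr addr0.
by rewrite /= !compFA autKV comp1F.
Qed.

Lemma apowP i : apow (-1 + i) = compF (autinv g) (apow i).
Proof.
have -> : apow i = compF g (apow (-1 + i)) by rewrite -apowS addrA subrr add0r.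
by rewrite compFA autK comp1F.
Qed.

Lemma apowD i j : apow (i + j) = compF (apow i) (apow j).
Proof.
elim/int_ind: i => [|n IH|n IH]; first by rewrite add0r /= comp1F.
  by rewrite -addn1 addnC PoszD -addrA !apowS IH compFA.
by rewrite -addn1 addnC PoszD opprD -addrA !apowP IH compFA.
Qed.

Lemma apow_ob i j k : i + j = k -> forall x, apow k x = apow i (apow j x).
Proof. by move=> <- x; rewrite apowD. Qed.
End Powers.

Definition primitive_idempotent (R : nzRingType) (e : R) :=
  e != 0 /\ forall f g : R, f * f = f -> g * g = g -> f * g = 0 -> g * f = 0 ->
    e = f + g -> f = 0 \/ g = 0.

Definition right_module_iso (K : fieldType) (A : falgType K) (U V : {vspace A}) :=
  exists h : 'End(A), [/\ (h @: U = V)%VS, (U :&: lker h = 0)%VS &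
    forall u a, u \in U -> h (u * a) = h u * a].

Record basic_algebra (K : fieldType) := BasicAlgebra {
  alg :> falgType K;
  vert : finType;
  idem : vert -> alg;
  idem_id : forall x, idem x * idem x = idem x;
  idem_orth : forall x y, x != y -> idem x * idem y = 0;
  idem_sum : \sum_x idem x = 1;
  idem_primitive : forall x, primitive_idempotent (idem x);
  alg_basic : forall x y, x != y ->
    ~ right_module_iso (<[idem x]> * fullv)%VS (<[idem y]> * fullv)%VS;
  alg_connected : forall z : alg, z * z = z -> (forall a, z * a = a * z) ->
    z = 0 \/ z = 1 }.

Section AlgebraCategory.
Variables (K : fieldType) (A : basic_algebra K).
Implicit Types x y z : vert A.
Local Notation e := (@idem K A).

(* A(x, y) = yAx *)
Definition peirce x y : {vspace A} := (<[e y]> * fullv * <[e x]>)%VS.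

Lemma peirceP x y (u : A) : reflect (e y * u * e x = u) (u \in peirce x y).
Proof.
apply: (iffP idP) => [|<-]; last by rewrite !memv_mul ?memv_line ?memvf.
have eAl : (<[e y]> * fullv <= fixedSpace (amull (e y)))%VS.
  apply/prodvP => u1 v /vlineP[c ->] _; apply/fixedSpaceP.
  by rewrite lfunE /= -scalerAl -scalerAr mulrA idem_id.
have ePl : (peirce x y <=
    fixedSpace (amull (e y)) :&: fixedSpace (amulr (e x)))%VS.
  apply/prodvP => v u1 /(subvP eAl)/fixedSpaceP; rewrite lfunE /= => ev.
  move=> /vlineP[c ->]; rewrite memv_cap; apply/andP; split.
    by apply/fixedSpaceP; rewrite lfunE /= mulrA ev.
  by apply/fixedSpaceP; rewrite lfunE /= -scalerAr -scalerAl -mulrA idem_id.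
move=> /(subvP ePl); rewrite memv_cap => /andP[/fixedSpaceP + /fixedSpaceP].
by rewrite !lfunE /= => -> ->.
Qed.

Local Notation homA x y := (subvs_of (peirce x y)).

Fact alg_id_subproof x : e x \in peirce x x.
Proof. by apply/peirceP; rewrite !idem_id. Qed.
Definition alg_id x : homA x x := Subvs (alg_id_subproof x).

Fact alg_comp_subproof x y z (g : homA y z) (f : homA x y) :
  vsval g * vsval f \in peirce x z.
Proof.
apply/peirceP; have /peirceP {2}<- := subvsP g; have /peirceP {2}<- := subvsP f.
have /peirceP {1}<- := subvsP g; have /peirceP {1}<- := subvsP f.
by rewrite !mulrA !idem_id -!mulrA !idem_id.
Qed.
Definition alg_comp x y z (g : homA y z) (f : homA x y) : homA x z :=
  Subvs (alg_comp_subproof g f).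

Fact alg_comp_linl x y z (f : homA x y) a (g g' : homA y z) :
  alg_comp (a *: g + g') f = a *: alg_comp g f + alg_comp g' f.
Proof. by apply: val_inj; rewrite /= mulrDl scalerAl. Qed.
Fact alg_comp_linr x y z (g : homA y z) a (f f' : homA x y) :
  alg_comp g (a *: f + f') = a *: alg_comp g f + alg_comp g f'.
Proof. by apply: val_inj; rewrite /= mulrDr scalerAr. Qed.
Fact alg_comp1m x y (f : homA x y) : alg_comp (alg_id y) f = f.
Proof.
by apply: val_inj => /=; have /peirceP <- := subvsP f; rewrite !mulrA idem_id.
Qed.
Fact alg_compm1 x y (f : homA x y) : alg_comp f (alg_id x) = f.
Proof.
by apply: val_inj => /=; have /peirceP <- := subvsP f; rewrite -!mulrA idem_id.
Qed.
Fact alg_compA x y z t (h : homA z t) (g : homA y z) (f : homA x y) :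
  alg_comp h (alg_comp g f) = alg_comp (alg_comp h g) f.
Proof. by apply: val_inj; rewrite /= mulrA. Qed.

Definition alg_cat : lincat K := @LinCat K (vert A) (fun x y => homA x y)
  alg_id alg_comp alg_comp_linl alg_comp_linr alg_comp1m alg_compm1 alg_compA.
End AlgebraCategory.

Definition no_nonzero_oriented_cycles (K : fieldType) (A : basic_algebra K) :=
  forall x : vert A, peirce x x = <[idem x]>%VS.


Section Repetitive.
Variables (K : fieldType) (A : basic_algebra K).
Local Notation homA x y := (subvs_of (@peirce K A x y)).
Local Notation dual x y := ('Hom(homA y x, K^o)).

Definition alg_compr x y z (f : homA x y) (g : homA y z) : homA x z :=
  alg_comp g f.

Fact alg_comp_is_linear x y z (g : homA y z) : linear (@alg_comp K A x y z g).
Proof. by move=> a u v; rewrite alg_comp_linr. Qed.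
HB.instance Definition _ x y z g := GRing.isLinear.Build K _ _ _
  (@alg_comp K A x y z g) (@alg_comp_is_linear x y z g).
Fact alg_compr_is_linear x y z (f : homA x y) : linear (@alg_compr x y z f).
Proof. by move=> a u v; rewrite /alg_compr alg_comp_linl. Qed.
HB.instance Definition _ x y z f := GRing.isLinear.Build K _ _ _
  (@alg_compr x y z f) (@alg_compr_is_linear x y z f).

(* [dual x y] is D(A(y, x)), with (b f)(u) = b (f u) and (g b)(u) = b (u g). *)
Definition dual_precomp x y z (b : dual y z) (f : homA x y) : dual x z :=
  (b \o linfun (@alg_comp K A z x y f))%VF.
Definition dual_postcomp x y z (g : homA y z) (b : dual x y) : dual x z :=
  (b \o linfun (@alg_compr y z x g))%VF.

Lemma dual_precompE x y z (b : dual y z) (f : homA x y) u :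
  dual_precomp b f u = b (alg_comp f u).
Proof. by rewrite !lfunE /= lfunE. Qed.
Lemma dual_postcompE x y z (g : homA y z) (b : dual x y) u :
  dual_postcomp g b u = b (alg_comp u g).
Proof. by rewrite !lfunE /= lfunE. Qed.

(* A morphism x^[i] -> y^[j] is encoded as a pair (f, b) of f in A(x, y) and   *)
(* b in D(A(y, x)), where f = 0 unless j = i and b = 0 unless j = i + 1; thus  *)
(* f^[i] is (f, 0) and b^[i] is (0, b).                                        *)
Definition rep_ob := (vert A * int)%type.
Implicit Types p q r s : rep_ob.

Definition rep_pred p q : pred (homA p.1 q.1 * dual p.1 q.1) :=
  fun u => ((u.1 == 0) || (q.2 == p.2)) && ((u.2 == 0) || (q.2 == p.2 + 1)).

Fact rep_submod_closed p q : submod_closed (@rep_pred p q).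
Proof.
split; first by rewrite unfold_in /rep_pred /= !eqxx.
move=> a u v /andP[u1 u2] /andP[v1 v2]; apply/andP; split; [clear u2 v2|clear u1 v1].
  case: (q.2 == p.2) u1 v1 => /=; rewrite ?orbT ?orbF // => /eqP -> /eqP ->.
  by rewrite scaler0 addr0.
case: (q.2 == _ + _) u2 v2 => /=; rewrite ?orbT ?orbF // => /eqP -> /eqP ->.
by rewrite scaler0 addr0.
Qed.
HB.instance Definition _ p q := GRing.isSubmodClosed.Build K _
  (@rep_pred p q) (@rep_submod_closed p q).

Record rep_hom p q := RepHom {
  rep_val : homA p.1 q.1 * dual p.1 q.1;
  rep_valP : rep_val \in @rep_pred p q }.
HB.instance Definition _ p q := [isSub for @rep_val p q].
HB.instance Definition _ p q := [Choice of rep_hom p q by <:].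
HB.instance Definition _ p q := [SubChoice_isSubZmodule of rep_hom p q by <:].
HB.instance Definition _ p q := [SubZmodule_isSubLmodule of rep_hom p q by <:].

Lemma rep_val_inj p q : injective (@rep_val p q).
Proof. exact: val_inj. Qed.

Fact rep_id_subproof p : (alg_id p.1, 0) \in @rep_pred p p.
Proof. by rewrite unfold_in /rep_pred /= !eqxx orbT. Qed.
Definition rep_id p : rep_hom p p := RepHom (rep_id_subproof p).

Definition rep_comp_val p q r (v : rep_hom q r) (u : rep_hom p q) :
    homA p.1 r.1 * dual p.1 r.1 :=
  (alg_comp (rep_val v).1 (rep_val u).1,
   dual_postcomp (rep_val v).1 (rep_val u).2 +
   dual_precomp (rep_val v).2 (rep_val u).1).

Fact alg_comp0m x y z (f : homA x y) : alg_comp (0 : homA y z) f = 0.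
Proof. exact: (@comp0m K (alg_cat A)). Qed.
Fact alg_compm0 x y z (f : homA y z) : alg_comp f (0 : homA x y) = 0.
Proof. exact: (@compm0 K (alg_cat A)). Qed.

Lemma dual_post0m x y z (b : dual x y) : dual_postcomp (0 : homA y z) b = 0.
Proof. by apply/lfunP => u; rewrite dual_postcompE alg_compm0 linear0 zero_lfunE. Qed.
Lemma dual_postm0 x y z (g : homA y z) : dual_postcomp g (0 : dual x y) = 0.
Proof. by apply/lfunP => u; rewrite dual_postcompE !zero_lfunE. Qed.
Lemma dual_pre0m x y z (f : homA x y) : dual_precomp (0 : dual y z) f = 0.
Proof. by apply/lfunP => u; rewrite dual_precompE !zero_lfunE. Qed.
Lemma dual_prem0 x y z (b : dual y z) : dual_precomp b (0 : homA x y) = 0.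
Proof. by apply/lfunP => u; rewrite dual_precompE alg_comp0m linear0 zero_lfunE. Qed.

Fact rep_comp_subproof p q r (v : rep_hom q r) (u : rep_hom p q) :
  rep_comp_val v u \in @rep_pred p r.
Proof.
rewrite unfold_in /rep_pred /rep_comp_val /=.
have /andP[] := rep_valP v; have /andP[] := rep_valP u.
case: (rep_val v) (rep_val u) => [g c] [f b] /= f0 b0 g0 c0; apply/andP; split.
  case/orP: g0 => [/eqP ->|/eqP ->]; first by rewrite alg_comp0m eqxx.
  by case/orP: f0 => [/eqP ->|/eqP ->]; rewrite ?alg_compm0 eqxx ?orbT.
have [_|rp] := eqVneq r.2 (p.2 + 1); first by rewrite orbT.
rewrite orbF; have -> : dual_postcomp g b = 0.
  case/orP: g0 => [/eqP ->|/eqP rq]; first by rewrite dual_post0m.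
  by case/orP: b0 => [/eqP ->|/eqP qp]; rewrite ?dual_postm0 // rq qp eqxx in rp *.
case/orP: c0 => [/eqP ->|/eqP rq]; first by rewrite dual_pre0m addr0.
case/orP: f0 => [/eqP ->|/eqP qp]; first by rewrite dual_prem0 addr0.
by rewrite rq qp eqxx in rp.
Qed.
(* (g, c) (f, b) = (g f, g b + c f); c b = 0 since both raise the index. *)
Definition rep_comp p q r (v : rep_hom q r) (u : rep_hom p q) : rep_hom p r :=
  RepHom (rep_comp_subproof v u).

Fact rep_comp_linl p q r (f : rep_hom p q) a (g g' : rep_hom q r) :
  rep_comp (a *: g + g') f = a *: rep_comp g f + rep_comp g' f.
Proof.
apply: rep_val_inj; rewrite /= /rep_comp_val /=; congr pair.
  exact: (@alg_comp_linl K A).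
apply/lfunP => u; rewrite !(add_lfunE, scale_lfunE, dual_postcompE, dual_precompE) /=.
rewrite alg_comp_linr linearP /= scalerDr; rewrite !addrA; congr (_ + _).
by rewrite addrAC.
Qed.
Fact rep_comp_linr p q r (g : rep_hom q r) a (f f' : rep_hom p q) :
  rep_comp g (a *: f + f') = a *: rep_comp g f + rep_comp g f'.
Proof.
apply: rep_val_inj; rewrite /= /rep_comp_val /=; congr pair.
  exact: (@alg_comp_linr K A).
apply/lfunP => u; rewrite !(add_lfunE, scale_lfunE, dual_postcompE, dual_precompE) /=.
rewrite alg_comp_linl linearP /= scalerDr; rewrite !addrA; congr (_ + _).
by rewrite addrAC.
Qed.
Fact rep_comp1m p q (f : rep_hom p q) : rep_comp (rep_id q) f = f.
Proof.
apply: rep_val_inj; rewrite /= /rep_comp_val /= alg_comp1m dual_pre0m addr0.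
rewrite [RHS]surjective_pairing; congr pair.
by apply/lfunP => u; rewrite dual_postcompE alg_compm1.
Qed.
Fact rep_compm1 p q (f : rep_hom p q) : rep_comp f (rep_id p) = f.
Proof.
apply: rep_val_inj; rewrite /= /rep_comp_val /= alg_compm1 dual_postm0 add0r.
rewrite [RHS]surjective_pairing; congr pair.
by apply/lfunP => u; rewrite dual_precompE alg_comp1m.
Qed.
Fact rep_compA p q r s (h : rep_hom r s) (g : rep_hom q r) (f : rep_hom p q) :
  rep_comp h (rep_comp g f) = rep_comp (rep_comp h g) f.
Proof.
apply: rep_val_inj; rewrite /= /rep_comp_val /= alg_compA; congr pair.
apply/lfunP => u; rewrite !(add_lfunE, dual_postcompE, dual_precompE) /=.
by rewrite !alg_compA addrA.
Qed.

Definition repcat : lincat K := @LinCat K rep_ob (fun p q => rep_hom p q)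
  rep_id rep_comp rep_comp_linl rep_comp_linr rep_comp1m rep_compm1 rep_compA.

End Repetitive.

Section RepetitiveAut.
Variables (K : fieldType) (A : basic_algebra K).
Local Notation Ahat := (repcat A).
Implicit Types p q r : rep_ob A.

Definition shift_ob (m : int) p : rep_ob A := (p.1, p.2 + m).
Fact shift_subproof m p q (u : rep_hom p q) :
  rep_val u \in @rep_pred K A (shift_ob m p) (shift_ob m q).
Proof.
have /andP[u1 u2] := rep_valP u; apply/andP; split => /=.
  by rewrite (inj_eq (addIr _)).
by rewrite addrAC (inj_eq (addIr _)).
Qed.
Definition shift_mor m p q (u : rep_hom p q) :
  rep_hom (shift_ob m p) (shift_ob m q) := RepHom (shift_subproof m u).
Fact shift_lin m p q a (f g : hom Ahat p q) :
  shift_mor m (a *: f + g) = a *: shift_mor m f + shift_mor m g.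
Proof. exact: rep_val_inj. Qed.
Fact shift_id m p : shift_mor m (rep_id p) = rep_id (shift_ob m p).
Proof. exact: rep_val_inj. Qed.
Fact shift_comp m p q r (g : hom Ahat q r) (f : hom Ahat p q) :
  shift_mor m (rep_comp g f) = rep_comp (shift_mor m g) (shift_mor m f).
Proof. exact: rep_val_inj. Qed.
Definition shift (m : int) : linfunctor Ahat Ahat :=
  @LinFunctor K Ahat Ahat (shift_ob m) (shift_mor m)
    (shift_lin m) (shift_id m) (shift_comp m).


Lemma rep_eqm x y (i j i' j' : int)
    (u : hom Ahat (x, i) (y, j)) (v : hom Ahat (x, i') (y, j'))
    (e1 : (x, i) = (x, i') :> Ahat) (e2 : (y, j) = (y, j') :> Ahat) :
  rep_val u = rep_val v -> eqm e2 \@ u = v \@ eqm e1.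
Proof.
move=> uv; have := e1; have := e2; case=> ej [ei]; subst i' j'.
by rewrite !eqm_id comp1m compm1; apply: rep_val_inj.
Qed.

Fact shift_ob_subproof (m m' : int) (mm' : m + m' = 0) p :
  shift_ob m' (shift_ob m p) = p.
Proof. by case: p => x i; rewrite /shift_ob /= -addrA mm' addr0. Qed.

Fact shiftK (m m' : int) : m + m' = 0 -> compF (shift m') (shift m) = idF Ahat.
Proof.
move=> mm'; apply: (@linfunctorP _ _ _ (compF (shift m') (shift m)) (idF Ahat)
  (shift_ob_subproof mm')) => -[x i] [y j] u.
exact: rep_eqm.
Qed.

Definition nakayama : autom Ahat :=
  Autom (@shiftK 1 (-1) (subrr _)) (@shiftK (-1) 1 (addNr _)).

Lemma nakayama_pow_ob (m : int) p : apow nakayama m p = (p.1, p.2 + m).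
Proof.
elim/int_ind: m p => [|n IH|n IH] [x i]; first by rewrite /= addr0.
  rewrite -addn1 addnC PoszD apowS /= IH /= /shift_ob /=.
  by rewrite (addrC 1) addrA.
rewrite -addn1 addnC PoszD opprD apowP /= IH /= /shift_ob /=.
by rewrite (addrC (-1)) addrA.
Qed.

(* [emb i] is id^[i] : A -> A^[i] followed by the inclusion of A^[i], and the  *)
(* restriction of [proj] to A^[i] is the inverse of id^[i].                    *)
Fact emb_subproof (i : int) x y (f : hom (alg_cat A) x y) :
  (f, 0) \in @rep_pred K A (x, i) (y, i).
Proof. by rewrite unfold_in /rep_pred /= !eqxx orbT. Qed.
Definition emb_mor (i : int) x y (f : hom (alg_cat A) x y) :
  hom Ahat (x, i) (y, i) := RepHom (emb_subproof i f).
Fact emb_lin (i : int) x y a (f g : hom (alg_cat A) x y) :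
  emb_mor i (a *: f + g) = a *: emb_mor i f + emb_mor i g.
Proof. by apply: rep_val_inj; congr pair; rewrite /= scaler0 addr0. Qed.
Fact emb_id (i : int) x : emb_mor i (idm (alg_cat A) x) = idm Ahat (x, i).
Proof. exact: rep_val_inj. Qed.
Fact emb_comp (i : int) x y z (g : hom (alg_cat A) y z) (f : hom (alg_cat A) x y) :
  emb_mor i (g \@ f) = emb_mor i g \@ emb_mor i f.
Proof.
apply: rep_val_inj; rewrite /= /rep_comp_val /=; congr pair.
by rewrite dual_postm0 dual_pre0m addr0.
Qed.
Definition emb (i : int) : linfunctor (alg_cat A) Ahat :=
  @LinFunctor K (alg_cat A) Ahat (fun x => (x, i)) (@emb_mor i)
    (@emb_lin i) (@emb_id i) (@emb_comp i).

Definition proj_mor p q (u : hom Ahat p q) : hom (alg_cat A) p.1 q.1 := (rep_val u).1.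
Fact proj_lin p q a (u v : hom Ahat p q) :
  proj_mor (a *: u + v) = a *: proj_mor u + proj_mor v.
Proof. by []. Qed.
Definition proj : linfunctor Ahat (alg_cat A) :=
  @LinFunctor K Ahat (alg_cat A) fst proj_mor proj_lin (fun=> erefl)
    (fun _ _ _ _ _ => erefl).

Lemma projK (i : int) : compF proj (emb i) = idF (alg_cat A).
Proof.
apply: (@linfunctorP _ _ _ (compF proj (emb i)) (idF (alg_cat A)) (fun=> erefl)).
by move=> x y f; rewrite !eqm_id comp1m compm1.
Qed.

Lemma embK (F : linfunctor (alg_cat A) Ahat) :
  (forall x, (F x).2 = 0) -> compF (emb 0) (compF proj F) = F.
Proof.
move=> F0; have e x : (compF (emb 0) (compF proj F)) x = F x.
  by rewrite /= -(F0 x); case: (F x).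
apply: (@linfunctorP _ _ _ _ F e) => x y f /=.
move: (e x) (e y) (F0 x) (F0 y) (fmor F f) => /=.
case: (F x) (F y) => [x' i] [y' j] /= ex ey i0 j0 u; subst i j.
apply: rep_eqm; rewrite /= /proj_mor [RHS]surjective_pairing; congr pair.
by have /andP[_] := rep_valP u; rewrite orbF => /eqP.
Qed.

(* phi(A^[0]) = A^[n]; only the objects matter, as A^[0] and A^[n] are full.   *)
Definition has_jump (phi : autom Ahat) (n : int) :=
  forall q, q.2 = n <-> exists2 p, p.2 = 0 & phi p = q.

Lemma aut_obK (C : lincat K) (g : autom C) x : autinv g (g x) = x.
Proof. by have := congr1 (fun F : linfunctor C C => F x) (autK g). Qed.
Lemma aut_obKV (C : lincat K) (g : autom C) x : g (autinv g x) = x.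
Proof. by have := congr1 (fun F : linfunctor C C => F x) (autKV g). Qed.
Lemma aut_inj (C : lincat K) (g : autom C) : injective g.
Proof. exact: can_inj (aut_obK g). Qed.
Lemma aut_mor0 (C : lincat K) (g : autom C) x y (f : hom C x y) :
  fmor g f = 0 -> f = 0.
Proof.
move=> gf; have := linfunctor_congr (autK g) f.
rewrite /= gf fmor0 compm0 => /esym f0.
rewrite -[f]compm1.
pose e := congr1 (fun H : linfunctor C C => H x) (autK g).
have -> : idm C x = eqm e \@ eqm (esym e) by rewrite eqm_comp eqm_id.
by rewrite compA f0 comp0m.
Qed.

Lemma rep_hom_level p q (u : rep_hom p q) : u != 0 -> q.2 = p.2 \/ q.2 = p.2 + 1.
Proof.
have [/eqP qp|np] := boolP (q.2 == p.2); first by left.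
have [/eqP qp|nq] := boolP (q.2 == p.2 + 1); first by right.
have /andP[] := rep_valP u; rewrite (negPf np) (negPf nq) !orbF => /eqP a /eqP b.
by case/eqP; apply: rep_val_inj; rewrite [LHS]surjective_pairing a b.
Qed.

Fact alg_id_neq0 x : alg_id x != 0 :> subvs_of (@peirce K A x x).
Proof.
apply/eqP => /(congr1 vsval) /= e0.
by have [] := @idem_primitive K A x; rewrite e0 eqxx.
Qed.

Lemma rep_hom_next x (i : int) : exists u : rep_hom (x, i) (x, i + 1), u != 0 :> hom Ahat _ _.
Proof.
pose V := subvs_of (@peirce K A x x).
have [b nb] : exists b : 'Hom(V, K^o), b != 0.
  exists (linfun (coord [tuple (alg_id x : V)] 0 : V -> K^o)).
  apply/eqP => /lfunP/(_ (alg_id x : V)); rewrite lfunE /= zero_lfunE.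
  have fx : free [tuple (alg_id x : V)] by rewrite seq1_free alg_id_neq0.
  by have := coord_free 0 0 fx; rewrite /= => -> /eqP; rewrite oner_eq0.
have bP : (0, b) \in @rep_pred K A (x, i) (x, i + 1).
  by rewrite unfold_in /rep_pred /= !eqxx orbT.
exists (RepHom bP); apply: contraNneq nb => nb0.
by have /(congr1 snd) /= -> := congr1 (@rep_val K A _ _) nb0.
Qed.

Lemma jump_level (phi : autom Ahat) (n : int) :
  has_jump phi n -> forall p, (phi p).2 = p.2 + n.
Proof.
move=> jn; pose L (i : int) := forall x, (phi (x, i)).2 = i + n.
have L0 : L 0 by move=> x; rewrite add0r; apply/jn; exists (x, 0).
have surj (i : int) : L i -> forall q, q.2 = i + n -> exists x, phi (x, i) = q.
  move=> Li q qi; have inj : injective (fun x => (phi (x, i)).1).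
    move=> x y /= exy; have : phi (x, i) = phi (y, i).
      by rewrite [LHS]surjective_pairing exy !Li -(Li y) -surjective_pairing.
    by move=> /aut_inj[].
  have [g _ gK] := injF_bij inj; exists (g q.1).
  by rewrite [LHS]surjective_pairing gK Li -qi -surjective_pairing.
have next x (i : int) : (phi (x, i + 1)).2 = (phi (x, i)).2 \/
    (phi (x, i + 1)).2 = (phi (x, i)).2 + 1.
  have [u nu] := rep_hom_next x i; apply: (@rep_hom_level _ _ (fmor phi (u : hom Ahat _ _))).
  by apply: contraNneq nu => u0; apply/eqP; apply: (@aut_mor0 _ phi _ _ _ u0).
have Lp (i : int) : L i -> L (i + 1).
  move=> Li x; case: (next x i) => h; last by rewrite h Li addrAC.
  have [y /aut_inj[_ /eqP]] := surj i Li _ (etrans h (Li x)).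
  by rewrite -subr_eq0 opprD addrA subrr add0r oppr_eq0 oner_eq0.
have Ln (i : int) : L i -> L (i - 1).
  move=> Li x; case: (next x (i - 1)); rewrite subrK Li => h.
    have [y /aut_inj[_ /eqP]] := surj i Li _ (esym h).
    by rewrite -subr_eq0 opprD addrA subrr add0r opprK oner_eq0.
  by rewrite addrAC h addrK.
have LL (i : int) : L i.
  elim/int_ind: i => // m Lm; first by rewrite -addn1 PoszD; apply: Lp.
  by rewrite -addn1 PoszD opprD; apply: Ln.
by move=> [x i]; rewrite LL.
Qed.

(* (id^[0])^{-1} phi nu^{-n} id^[0], and the candidate inverse *)
Definition zero_part (phi : autom Ahat) (n : int) : linfunctor (alg_cat A) (alg_cat A) :=
  compF proj (compF phi (compF (apow nakayama (- n)) (emb 0))).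
Definition zero_part_inv (phi : autom Ahat) (n : int) :
    linfunctor (alg_cat A) (alg_cat A) :=
  compF proj (compF (apow nakayama n) (compF (autinv phi) (emb 0))).

Section ZeroPart.
Variables (phi : autom Ahat) (n : int) (phi_jump : has_jump phi n).

Lemma zero_part_emb :
  compF (emb 0) (zero_part phi n) = compF phi (compF (apow nakayama (- n)) (emb 0)).
Proof.
apply: embK => x; rewrite [LHS](jump_level phi_jump) /= nakayama_pow_ob /=.
by rewrite sub0r addNr.
Qed.

Lemma zero_part_inv_emb : compF (emb 0) (zero_part_inv phi n) =
  compF (apow nakayama n) (compF (autinv phi) (emb 0)).
Proof.
apply: embK => x; rewrite /= nakayama_pow_ob /=.
have <- := jump_level phi_jump (autinv phi (x, 0)).
by rewrite aut_obKV.
Qed.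

Fact zero_partK : compF (zero_part_inv phi n) (zero_part phi n) = idF (alg_cat A).
Proof.
rewrite {1}/zero_part_inv -!compFA zero_part_emb (compFA (autinv phi)) autK comp1F.
by rewrite (compFA (apow _ n)) -apowD subrr comp1F projK.
Qed.
Fact zero_partKV : compF (zero_part phi n) (zero_part_inv phi n) = idF (alg_cat A).
Proof.
rewrite {1}/zero_part -!compFA zero_part_inv_emb (compFA (apow _ (- n))) -apowD.
by rewrite addNr comp1F (compFA phi) autKV comp1F projK.
Qed.
Definition zero_aut : autom (alg_cat A) := Autom zero_partK zero_partKV.
End ZeroPart.
End RepetitiveAut.

(* [homog n f] : f lies in the degree-n part of its morphism space; the last   *)
(* two axioms say that each morphism space is the direct sum of these parts.   *)
Record grcat (K : fieldType) := GrCat {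
  gcat :> lincat K;
  homog : forall (n : int) (x y : gcat), hom gcat x y -> Prop;
  homog0 : forall n (x y : gcat), homog n (0 : hom gcat x y);
  homog_lin : forall n (x y : gcat) a (f g : hom gcat x y),
    homog n f -> homog n g -> homog n (a *: f + g);
  homog_id : forall x : gcat, homog 0 (idm gcat x);
  homog_comp : forall m n (x y z : gcat) (g : hom gcat y z) (f : hom gcat x y),
    homog m g -> homog n f -> homog (m + n) (g \@ f);
  homog_span : forall (x y : gcat) (f : hom gcat x y),
    exists (s : seq int) (f_ : int -> hom gcat x y),
      (forall n, homog n (f_ n)) /\ f = \sum_(n <- s) f_ n;
  homog_free : forall (x y : gcat) (s : seq int) (f_ : int -> hom gcat x y),
    uniq s -> (forall n, homog n (f_ n)) -> \sum_(n <- s) f_ n = 0 ->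
    forall n, n \in s -> f_ n = 0 }.

Arguments homog {K} C n {x y} f : rename.

(* degree-preserving functors (H, r) *)
Record dpfunctor (K : fieldType) (B A : grcat K) := DpFunctor {
  dpf :> linfunctor B A;
  dpr : B -> int;
  dpP : forall (x y : B) (a : int) (f : hom B x y),
    homog B (dpr y + a) f -> homog A (a + dpr x) (fmor dpf f) }.

Section GrCat2.
Variable K : fieldType.
Implicit Types A B C : grcat K.

Fact dp_id_subproof B (x y : B) (a : int) (f : hom B x y) :
  homog B (0 + a) f -> homog B (a + 0) f.
Proof. by rewrite add0r addr0. Qed.
Definition dp_id B : dpfunctor B B :=
  @DpFunctor K B B (idF B) (fun=> 0) (@dp_id_subproof B).

Section Comp.
Variables (A B C : grcat K) (G : dpfunctor A C) (F : dpfunctor B A).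
Fact dp_comp_subproof (x y : B) (a : int) (f : hom B x y) :
  homog B (dpr F y + dpr G (F y) + a) f ->
  homog C (a + (dpr F x + dpr G (F x))) (fmor (compF G F) f).
Proof.
rewrite -addrA => /dpP h; rewrite addrA; apply: dpP.
by rewrite addrA.
Qed.
Definition dp_comp : dpfunctor B C := @DpFunctor K B C (compF G F)
  (fun x => dpr F x + dpr G (F x)) dp_comp_subproof.
End Comp.

(* the 2-morphisms of Z-GrCat; [gr2iso] and [gr_equivalence] are isomorphism  *)
(* of 1-morphisms and equivalence in this 2-category *)
Record gr2mor A B (F G : dpfunctor B A) := Gr2Mor {
  gr2 :> nattrans F G;
  gr2P : forall x, homog A (dpr F x - dpr G x) (gr2 x) }.

Definition gr2iso A B (F G : dpfunctor B A) :=
  exists (th : gr2mor F G) (th' : gr2mor G F), forall x,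
    th' x \@ th x = idm A (F x) /\ th x \@ th' x = idm A (G x).

Definition gr_equivalence A B (F : dpfunctor B A) :=
  exists G : dpfunctor A B,
    gr2iso (dp_comp G F) (dp_id B) /\ gr2iso (dp_comp F G) (dp_id A).

Definition gr_isomorphism A B (F : dpfunctor B A) :=
  exists G : linfunctor A B, compF G F = idF B /\ compF F G = idF A.

Section FullSubcategory.
Variables (C : grcat K) (P : C -> Prop).
Implicit Types x y z t : {x : C | P x}.

Definition fullsub_cat : lincat K :=
  @LinCat K {x : C | P x} (fun x y => hom C (sval x) (sval y))
    (fun x => idm C (sval x)) (fun x y z g f => g \@ f)
    (fun x y z f => @comp_linl _ _ _ _ _ f) (fun x y z g => @comp_linr _ _ _ _ _ g)
    (fun x y f => comp1m f) (fun x y f => compm1 f)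
    (fun x y z t h g f => compA h g f).

Definition fullsub : grcat K := @GrCat K fullsub_cat
  (fun n x y f => homog C n (f : hom C (sval x) (sval y)))
  (fun n x y => homog0 n (sval x) (sval y))
  (fun n x y => @homog_lin _ C n (sval x) (sval y))
  (fun x => homog_id (sval x))
  (fun m n x y z => @homog_comp _ C m n (sval x) (sval y) (sval z))
  (fun x y => @homog_span _ C (sval x) (sval y))
  (fun x y => @homog_free _ C (sval x) (sval y)).
End FullSubcategory.

Section Restriction.
Variables (A B : grcat K) (F : dpfunctor B A) (P : B -> Prop) (Q : A -> Prop).
Hypothesis PQ : forall x, P x -> Q (F x).

Definition restr_functor : linfunctor (fullsub P) (fullsub Q) :=
  @LinFunctor K (fullsub P) (fullsub Q)
    (fun x => exist Q (F (sval x)) (PQ (svalP x)))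
    (fun x y f => fmor F (f : hom B (sval x) (sval y)))
    (fun x y => @fmor_lin _ _ _ F (sval x) (sval y))
    (fun x => fmor1 F (sval x))
    (fun x y z => @fmorM _ _ _ F (sval x) (sval y) (sval z)).
Definition restr : dpfunctor (fullsub P) (fullsub Q) :=
  @DpFunctor K (fullsub P) (fullsub Q) restr_functor
    (fun x => dpr F (sval x)) (fun x y => @dpP _ _ _ F (sval x) (sval y)).
End Restriction.
End GrCat2.

Section Orbit.
Variables (K : fieldType) (C : lincat K) (g : autom C).
Implicit Types x y z t : C.

Definition orbit_hom x y := dsum (fun k : int => hom C (apow g k x) y).

Section Omul.
Variables (x y z : C) (l k m : int) (e : l + k = m).
(* q_l g^l(f_k), as a morphism on g^m x = g^l (g^k x) *)
Definition orbit_mul (q : hom C (apow g l y) z) (f : hom C (apow g k x) y) :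
    hom C (apow g m x) z :=
  q \@ fmor (apow g l) f \@ eqm (apow_ob g e x).

Lemma orbit_mul_linl f a q q' :
  orbit_mul (a *: q + q') f = a *: orbit_mul q f + orbit_mul q' f.
Proof. by rewrite /orbit_mul !comp_linl. Qed.
Lemma orbit_mul_linr q a f f' :
  orbit_mul q (a *: f + f') = a *: orbit_mul q f + orbit_mul q f'.
Proof. by rewrite /orbit_mul fmor_lin comp_linr comp_linl. Qed.
Lemma orbit_mul0m f : orbit_mul 0 f = 0.
Proof. by rewrite /orbit_mul !comp0m. Qed.
Lemma orbit_mulm0 q : orbit_mul q 0 = 0.
Proof. by rewrite /orbit_mul fmor0 compm0 comp0m. Qed.
Lemma orbit_mul_suml f J (r : seq J) (q : J -> hom C (apow g l y) z) :
  orbit_mul (\sum_(j <- r) q j) f = \sum_(j <- r) orbit_mul (q j) f.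
Proof. by rewrite /orbit_mul !comp_suml. Qed.
Lemma orbit_mul_sumr q J (r : seq J) (f : J -> hom C (apow g k x) y) :
  orbit_mul q (\sum_(j <- r) f j) = \sum_(j <- r) orbit_mul q (f j).
Proof. by rewrite /orbit_mul fmor_sum comp_sumr comp_suml. Qed.
End Omul.

Lemma orbit_mul_irr2 x y z t (a l k l' k' c m : int) (r : hom C (apow g a z) t)
    (q : orbit_hom y z) (f : orbit_hom x y) (e1 : c + k = m) (e2 : a + l = c)
    (e1' : c + k' = m) (e2' : a + l' = c) : l = l' -> k = k' ->
  orbit_mul e1 (orbit_mul e2 r (q l)) (f k) =
  orbit_mul e1' (orbit_mul e2' r (q l')) (f k').
Proof.
move=> ll kk; subst l' k'.
by rewrite (Prop_irrelevance e1' e1) (Prop_irrelevance e2' e2).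
Qed.

Lemma orbit_mulA x y z t (a l k b c m : int) (e1 : a + b = m) (e2 : l + k = b)
    (e3 : c + k = m) (e4 : a + l = c) (r : hom C (apow g a z) t)
    (q : hom C (apow g l y) z) (f : hom C (apow g k x) y) :
  orbit_mul e1 r (orbit_mul e2 q f) = orbit_mul e3 (orbit_mul e4 r q) f.
Proof.
subst b c; rewrite /orbit_mul !fmorM fmor_eqm !compA.
rewrite -!(compA _ (eqm _)) eqm_comp -!compA; congr (_ \@ _); congr (_ \@ _).
rewrite !compA; have := linfunctor_congr (apowD g a l) f; rewrite /= => H.
rewrite (eqm_irr (apow_ob g erefl y) (congr1 (fun H : linfunctor C C => H y) (apowD g a l))).
by rewrite H -compA eqm_comp; congr (_ \@ _); apply: eqm_irr.
Qed.

Lemma subKl (l m : int) : l + (m - l) = m.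
Proof. by rewrite addrC subrK. Qed.

(* degree-m component of the composite: the sum of q_l g^l(f_k) over l + k = m *)
Definition orbit_comp_fun x y z (q : orbit_hom y z) (f : orbit_hom x y) (m : int) :
    hom C (apow g m x) z :=
  \sum_(l \in [set: int]) orbit_mul (subKl l m) (q l) (f (m - l)).

Lemma orbit_comp_funE x y z (q : orbit_hom y z) (f : orbit_hom x y) (m : int) s :
  uniq s -> (forall l, l \notin s -> q l = 0) ->
  orbit_comp_fun q f m = \sum_(l <- s) orbit_mul (subKl l m) (q l) (f (m - l)).
Proof.
by move=> us qs; apply: fsbigT_seq => // l /qs ->; rewrite orbit_mul0m.
Qed.

Fact orbit_comp_finite x y z (q : orbit_hom y z) (f : orbit_hom x y) :
  finite_set [set m | orbit_comp_fun q f m != 0].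
Proof.
have [s us qs] := dsum_supp q; have [t _ ft] := dsum_supp f.
apply: (finite_supp (s := [seq l + k | l <- s, k <- t])) => m.
move=> nm; rewrite (orbit_comp_funE _ _ us qs) big_seq big1 // => l ls.
rewrite (ft (m - l)) ?orbit_mulm0 //; apply: contra nm => mt.
by apply/allpairsP; exists (l, m - l); rewrite subKl.
Qed.
Definition orbit_comp x y z (q : orbit_hom y z) (f : orbit_hom x y) : orbit_hom x z :=
  Dsum (orbit_comp_finite q f).

Definition orbit_id x : orbit_hom x x :=
  @dinj K int (fun k => hom C (apow g k x) x) 0 (idm C x).

Lemma orbit_id0 x : orbit_id x 0 = idm C x.
Proof. exact: (@dinj_id K int (fun k => hom C (apow g k x) x) 0 (idm C x)). Qed.
Lemma orbit_id_ne x k : k != 0 -> orbit_id x k = 0.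
Proof.
rewrite eq_sym.
exact: (@dinj_ne K int (fun k => hom C (apow g k x) x) 0 (idm C x)).
Qed.

Fact orbit_linl x y z (f : orbit_hom x y) a (q q' : orbit_hom y z) :
  orbit_comp (a *: q + q') f = a *: orbit_comp q f + orbit_comp q' f.
Proof.
have [s us qs] := dsum_supp q; have [t ut qt] := dsum_supp q'.
have H l : l \notin undup (s ++ t) -> q l = 0 /\ q' l = 0.
  by rewrite mem_undup mem_cat negb_or => /andP[/qs ? /qt ?].
apply: dsumP => m /=.
rewrite !(@orbit_comp_funE _ _ _ _ _ m (undup (s ++ t)) (undup_uniq _)).
- by rewrite scaler_sumr -big_split; apply: eq_bigr => l _; rewrite orbit_mul_linl.
- by move=> l /H[].
- by move=> l /H[].
- by move=> l /H[h h'] /=; rewrite h h' scaler0 addr0.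
Qed.

Fact orbit_linr x y z (q : orbit_hom y z) a (f f' : orbit_hom x y) :
  orbit_comp q (a *: f + f') = a *: orbit_comp q f + orbit_comp q f'.
Proof.
have [s us qs] := dsum_supp q; apply: dsumP => m /=; rewrite !(orbit_comp_funE _ _ us qs).
by rewrite scaler_sumr -big_split; apply: eq_bigr => l _; rewrite orbit_mul_linr.
Qed.

Fact orbit_comp1m x y (f : orbit_hom x y) : orbit_comp (orbit_id y) f = f.
Proof.
apply: dsumP => m /=; rewrite (@orbit_comp_funE _ _ _ _ _ _ [:: 0]) //; last first.
  by move=> l; rewrite inE => /orbit_id_ne.
rewrite big_seq1 orbit_id0; move: (subKl 0 m); rewrite subr0 => e.
by rewrite /orbit_mul eqm_id compm1 comp1m.
Qed.

Fact orbit_compm1 x y (f : orbit_hom x y) : orbit_comp f (orbit_id x) = f.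
Proof.
have [s us fs] := dsum_supp f; apply: dsumP => m /=; rewrite (orbit_comp_funE _ _ us fs).
have H l : l != m -> orbit_mul (subKl l m) (f l) (orbit_id x (m - l)) = 0.
  by move=> lm; rewrite orbit_id_ne ?orbit_mulm0 // subr_eq0 eq_sym.
have [ms|/[dup] ms /fs ->] := boolP (m \in s); last first.
  by rewrite big_seq big1 // => l ls; apply: H; apply: contraNneq ms => <-.
rewrite (bigD1_seq m ms us) big1 => [|l lm]; last exact: H.
have -> : orbit_mul (subKl m m) (f m) (orbit_id x (m - m)) = f m.
  move: (subKl m m); rewrite subrr => e.
  by rewrite orbit_id0 /orbit_mul fmor1 compm1 eqm_id compm1.
exact: addr0.
Qed.

Fact orbit_compA x y z t (r : orbit_hom z t) (q : orbit_hom y z) (f : orbit_hom x y) :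
  orbit_comp r (orbit_comp q f) = orbit_comp (orbit_comp r q) f.
Proof.
have [s us rs] := dsum_supp r; have [u uu qu] := dsum_supp q.
apply: dsumP => m /=; rewrite (orbit_comp_funE _ _ us rs).
pose v := undup [seq a + l | a <- s, l <- u].
have rqv c a : a \in s -> c \notin v -> q (c - a) = 0.
  move=> sa; rewrite mem_undup => nc; apply: qu; apply: contra nc => cu.
  by apply/allpairsP; exists (a, c - a); rewrite subKl.
have rq c : c \notin v -> orbit_comp r q c = 0.
  move=> cv /=; rewrite (orbit_comp_funE _ _ us rs) big_seq big1 // => a sa.
  by rewrite (rqv c a) // orbit_mulm0.
rewrite (orbit_comp_funE _ _ (undup_uniq _) rq).
under [RHS]eq_bigr => c _ do rewrite /= (orbit_comp_funE _ _ us rs) orbit_mul_suml.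
rewrite exchange_big; apply: eq_big_seq => a sa.
rewrite /= (orbit_comp_funE _ _ uu qu) orbit_mul_sumr.
pose F c := orbit_mul (subKl c m) (orbit_mul (subKl a c) (r a) (q (c - a))) (f (m - c)).
rewrite -[RHS]/(\sum_(c <- v) F c) -(@fsbigT_seq _ _ F) ?undup_uniq //; last first.
  by move=> c cv; rewrite /F (rqv c a) // orbit_mulm0 orbit_mul0m.
rewrite (@fsbigT_seq _ _ F (map (+%R a) u)).
- rewrite big_map; apply: eq_bigr => l _; rewrite /F.
  have e3 : a + l + (m - a - l) = m by rewrite -addrA subKl subKl.
  rewrite (orbit_mulA _ _ e3 erefl); apply: orbit_mul_irr2.
    by rewrite addrAC subrr add0r.
  by rewrite opprD addrA.
- by rewrite map_inj_uniq //; apply: addrI.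
- move=> c cu; rewrite /F qu ?orbit_mulm0 ?orbit_mul0m //.
  by apply: contra cu => cu; apply/mapP; exists (c - a); rewrite ?subKl.
Qed.

Definition orbit_cat : lincat K := @LinCat K C orbit_hom orbit_id orbit_comp
  orbit_linl orbit_linr orbit_comp1m orbit_compm1 orbit_compA.

Definition orbit_homog (n : int) x y (f : orbit_hom x y) := forall k, k != n -> f k = 0.

Fact orbit_homog0 n x y : @orbit_homog n x y 0.
Proof. by []. Qed.
Fact orbit_homog_lin n x y a (f h : hom orbit_cat x y) :
  orbit_homog n f -> orbit_homog n h -> orbit_homog n (a *: f + h).
Proof. by move=> fn hn k kn /=; rewrite fn // hn // scaler0 addr0. Qed.
Fact orbit_homog_id x : orbit_homog 0 (orbit_id x).
Proof. by move=> k /orbit_id_ne. Qed.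
Fact orbit_homog_comp m n x y z (q : orbit_hom y z) (f : orbit_hom x y) :
  orbit_homog m q -> orbit_homog n f -> orbit_homog (m + n) (orbit_comp q f).
Proof.
move=> qm fn k kmn; rewrite /= (@orbit_comp_funE _ _ _ _ _ _ [:: m]) //; last first.
  by move=> l; rewrite inE => /qm.
rewrite big_seq1 fn ?orbit_mulm0 //; apply: contra kmn => /eqP <-.
by rewrite subKl.
Qed.
Fact orbit_homog_span x y (f : orbit_hom x y) :
  exists (s : seq int) (f_ : int -> orbit_hom x y),
    (forall n, orbit_homog n (f_ n)) /\ f = \sum_(n <- s) f_ n.
Proof.
have [s us fs] := dsum_supp f; exists s, (fun n => dinj (f n)); split; last first.
  exact: dsum_dinjE.
by move=> n k kn; rewrite dinj_ne // eq_sym.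
Qed.
Fact orbit_homog_free x y (s : seq int) (f_ : int -> orbit_hom x y) :
  uniq s -> (forall n, orbit_homog n (f_ n)) -> \sum_(n <- s) f_ n = 0 ->
  forall n, n \in s -> f_ n = 0.
Proof.
move=> us fh /(congr1 (@dcomp _ _ _)) f0 n ns; apply: dsumP => k.
have [->|kn] := eqVneq k n; last exact: fh.
have := congr1 (fun h => h n) f0; rewrite dsum_sumE (bigD1_seq n ns us) big1.
  by rewrite /= addr0.
by move=> j jn; apply: fh; rewrite eq_sym.
Qed.

Definition orbit_grcat : grcat K := @GrCat K orbit_cat orbit_homog orbit_homog0
  orbit_homog_lin orbit_homog_id orbit_homog_comp orbit_homog_span orbit_homog_free.

(* P contains one representative of each orbit of objects; the full            *)
(* subcategory of [orbit_grcat] on P is then the classical orbit category.     *)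
Definition orbit_transversal (P : C -> Prop) :=
  forall x, exists! y, P y /\ exists k : int, apow g k x = y.
End Orbit.

(* A family (eta_k : h^k => g^k)_k with eta_(k+l) = (eta_k g^l) o (h^k eta_l); *)
(* it is determined by eta_1. The [eqm] identify g^(k+l) x with g^k (g^l x).   *)
Record equivariant (K : fieldType) (C : lincat K) (h g : autom C) := Equivariant {
  eqv :> forall k : int, nattrans (apow h k) (apow g k);
  eqv_iso : forall k, is_natiso (eqv k);
  eqvD : forall k l x,
    eqm (apow_ob g erefl x) \@ eqv (k + l) x =
    eqv k (apow g l x) \@ fmor (apow h k) (eqv l x) \@ eqm (apow_ob h erefl x) }.

Section OrbitFunctor.
Variables (K : fieldType) (C : lincat K) (h g : autom C) (eta : equivariant h g).

Fact orbit_mor_finite x y (f : orbit_hom g x y) :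
  finite_set [set k | f k \@ eta k x != 0].
Proof.
have [s _ fs] := dsum_supp f.
by apply: (finite_supp (s := s)) => k /fs ->; rewrite comp0m.
Qed.
Definition orbit_mor x y (f : orbit_hom g x y) : orbit_hom h x y :=
  Dsum (orbit_mor_finite f).

Lemma eqv0 x : eta 0 x = idm C x.
Proof.
have := eqvD eta 0 0 x; rewrite !(@eqm_id K C x) comp1m compm1 /=.
move=> e; have [i [i1 _]] := eqv_iso eta 0 x.
by rewrite -i1 {2}e compA i1 comp1m.
Qed.

Fact orbit_mor_lin x y a (f f' : orbit_hom g x y) :
  orbit_mor (a *: f + f') = a *: orbit_mor f + orbit_mor f'.
Proof. by apply: dsumP => k; rewrite /= comp_linl. Qed.
Fact orbit_mor_id x : orbit_mor (orbit_id g x) = orbit_id h x.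
Proof.
apply: dsumP => k; have [->|k0] := eqVneq k 0.
  by rewrite /orbit_mor [LHS]/dcomp !orbit_id0 eqv0 comp1m.
by rewrite /orbit_mor [LHS]/dcomp !orbit_id_ne // comp0m.
Qed.
Fact orbit_mor_comp x y z (q : orbit_hom g y z) (f : orbit_hom g x y) :
  orbit_mor (orbit_comp q f) = orbit_comp (orbit_mor q) (orbit_mor f).
Proof.
have [s us qs] := dsum_supp q; apply: dsumP => m /=.
rewrite (orbit_comp_funE _ _ us qs) (orbit_comp_funE _ _ us) => [|l /qs]; last first.
  by move=> /= ->; rewrite comp0m.
rewrite comp_suml; apply: eq_bigr => l _ /=.
move: (f (m - l)) (subKl l m); move: (m - l) => k u e; subst m.
rewrite /orbit_mul fmorM -!compA eqvD; congr (_ \@ _).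
by rewrite !compA ntcP.
Qed.

Definition orbit_lin : linfunctor (orbit_grcat g) (orbit_grcat h) :=
  @LinFunctor K (orbit_grcat g) (orbit_grcat h) id orbit_mor orbit_mor_lin orbit_mor_id orbit_mor_comp.

Fact orbit_lin_homog (x y : orbit_grcat g) (a : int) (f : hom (orbit_grcat g) x y) :
  homog (orbit_grcat g) (0 + a) f -> homog (orbit_grcat h) (a + 0) (fmor orbit_lin f).
Proof. by rewrite add0r addr0 => fa k ka; rewrite /= fa // comp0m. Qed.

(* (id, eta)/Z; it preserves degrees, so its degree adjuster is 0 *)
Definition orbit_functor : dpfunctor (orbit_grcat g) (orbit_grcat h) :=
  @DpFunctor K (orbit_grcat g) (orbit_grcat h) orbit_lin (fun=> 0) orbit_lin_homog.

(* the same functor between the full subcategories on the objects in P *)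
Definition orbit_functor_on (P : C -> Prop) :
    dpfunctor (@fullsub K (orbit_grcat g) P) (@fullsub K (orbit_grcat h) P) :=
  @restr K (orbit_grcat h) (orbit_grcat g) orbit_functor P P (fun _ Px => Px).
End OrbitFunctor.

Record quiver (V : finType) := Quiver {
  arrow : finType;
  src : arrow -> V;
  tgt : arrow -> V }.

Section PathAlgebra.
Variables (K : fieldType) (V : finType) (Q : quiver V).
Implicit Types (x : V) (w : seq (arrow Q)).

(* (x, [:: a1; ...; am]) is the path am ... a1 with source x. *)
Fixpoint is_path x w :=
  if w is a :: w' then (src a == x) && is_path (tgt a) w' else true.
Definition path_end x w := last x [seq tgt a | a <- w].

Lemma is_path_cat x w1 w2 :
  is_path x (w1 ++ w2) = is_path x w1 && is_path (path_end x w1) w2.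
Proof. by elim: w1 x => //= a w1 IH x; rewrite IH andbA. Qed.

Definition path_pred (r : V * seq (arrow Q)) := is_path r.1 r.2.
Definition qpath := {r | path_pred r}.
Implicit Types p q u v : qpath.
Definition plen p := size (sval p).2.

Fact ptake_subproof (i : nat) p : path_pred ((sval p).1, take i (sval p).2).
Proof.
by have := svalP p; rewrite /path_pred -{1}(cat_take_drop i (sval p).2) is_path_cat => /andP[].
Qed.
Definition ptake i p : qpath :=
  exist path_pred _ (ptake_subproof i p).
Fact pdrop_subproof (i : nat) p :
  path_pred (path_end (sval p).1 (take i (sval p).2), drop i (sval p).2).
Proof.
by have := svalP p; rewrite /path_pred -{1}(cat_take_drop i (sval p).2) is_path_cat => /andP[].
Qed.
Definition pdrop i p : qpath :=
  exist path_pred _ (pdrop_subproof i p).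

Lemma ptake_all p : ptake (plen p) p = p.
Proof. by apply: val_inj; rewrite /= take_size; case: p => -[]. Qed.
Lemma pdrop0 p : pdrop 0 p = p.
Proof. by apply: val_inj; rewrite /= take0 drop0; case: p => -[]. Qed.
Lemma plen_take i p : (i <= plen p)%N -> plen (ptake i p) = i.
Proof. by move=> ip; rewrite /plen /= size_takel. Qed.
Lemma plen_drop i p : plen (pdrop i p) = (plen p - i)%N.
Proof. by rewrite /plen /= size_drop. Qed.
Lemma ptake_take i j p : (j <= i)%N -> ptake j (ptake i p) = ptake j p.
Proof. by move=> ji; apply: val_inj; rewrite /= take_takel. Qed.
Lemma pdrop_drop i j p : pdrop i (pdrop j p) = pdrop (i + j) p.
Proof.
apply: val_inj; rewrite /= drop_drop; congr pair.
by rewrite /path_end -last_cat -map_cat -takeD addnC.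
Qed.
Lemma pdrop_take i j p : pdrop j (ptake (i + j) p) = ptake i (pdrop j p).
Proof.
apply: val_inj; rewrite /= take_takel ?leq_addl //; congr pair.
by rewrite take_drop.
Qed.

(* finitely supported functions on the set of paths *)
Definition path_alg := dsum (fun _ : qpath => K^o : lmodType K).
HB.instance Definition _ := GRing.Lmodule.on path_alg.
Implicit Types f g h : path_alg.

Definition path_mul_fun f g p : K^o :=
  \sum_(i < (plen p).+1) f (pdrop i p) * g (ptake i p).

Fact path_mul_finite f g : finite_set [set p | path_mul_fun f g p != 0].
Proof.
have [s _ fs] := dsum_supp f; have [t _ gt] := dsum_supp g.
pose c u v := ((sval v).1, (sval v).2 ++ (sval u).2).
apply: (finite_supp (V := fun _ => K^o)
  (s := pmap insub [seq c u v | u <- s, v <- t])) => p np.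
rewrite /path_mul_fun big1 // => i _.
have [ds|/fs ->] := boolP (pdrop i p \in s); last by rewrite mul0r.
have [dt|/gt ->] := boolP (ptake i p \in t); last by rewrite mulr0.
case/negP: np; rewrite mem_pmap; apply/mapP; exists (sval p).
  apply/allpairsP; exists (pdrop i p, ptake i p); split=> //.
  by rewrite /c /= cat_take_drop; case: (sval p).
by rewrite valK.
Qed.
Definition path_mul f g : path_alg := Dsum (path_mul_finite f g).

Fact path_one_finite :
  finite_set [set p : qpath | (plen p == 0)%:R != 0 :> K^o].
Proof.
apply: (finite_supp (V := fun _ => K^o)
  (s := pmap insub [seq (x, [::]) | x <- enum V])) => p np.
case: eqP => // p0; case/negP: np; rewrite mem_pmap; apply/mapP.
exists (sval p); last by rewrite valK.
apply/mapP; exists (sval p).1; first by rewrite mem_enum.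
by move: p0; rewrite /plen; case: (sval p) => x [].
Qed.
Definition path_one : path_alg :=
  @Dsum _ _ (fun _ => K^o : lmodType K) _ path_one_finite.

Fact path_mulA : associative path_mul.
Proof.
move=> f g h; apply: dsumP => p /=; rewrite /path_mul_fun.
pose n := (plen p).+1.
pose F i j := f (pdrop i p) * (g (pdrop j (ptake i p)) * h (ptake j p)).
transitivity (\sum_(0 <= i < n) \sum_(0 <= j < n | (j <= i)%N) F i j).
  rewrite [RHS]big_mkord; apply: eq_bigr => i _ /=; rewrite /path_mul_fun mulr_sumr.
  have ip : (i <= plen p)%N by rewrite -ltnS.
  rewrite plen_take // -(big_mkord xpredT (fun j =>
    f (pdrop i p) * (g (pdrop j (ptake i p)) * h (ptake j (ptake i p))))).
  rewrite (@big_nat_widen _ _ _ 0 i.+1 n) //; apply: eq_big => // j.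
  by rewrite /= ltnS => ji; rewrite /F ptake_take.
rewrite (exchange_big_dep_nat xpredT) //= big_mkord; apply: eq_bigr => j _.
have jp : (j <= plen p)%N by rewrite -ltnS.
rewrite -(@big_nat_widenl _ _ _ j 0 n xpredT) // -{1}[nat_of_ord j]add0n big_addn.
rewrite /path_mul_fun mulr_suml plen_drop /n subSn // big_mkord.
apply: eq_bigr => i _; rewrite /F pdrop_drop pdrop_take.
by rewrite mulrA.
Qed.

Fact path_mul1 : left_id path_one path_mul.
Proof.
move=> f; apply: dsumP => p /=; rewrite /path_mul_fun big_ord_recr /= big1 => [|i _].
  by rewrite plen_drop subnn mul1r ptake_all add0r.
by rewrite plen_drop subn_eq0 leqNgt ltn_ord mul0r.
Qed.
Fact path_mulr1 : right_id path_one path_mul.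
Proof.
move=> f; apply: dsumP => p /=; rewrite /path_mul_fun big_ord_recl /= big1 => [|i _].
  by rewrite plen_take // mulr1 pdrop0 addr0.
by rewrite plen_take // mulr0.
Qed.
Fact path_mulDl : left_distributive path_mul +%R.
Proof.
move=> f g h; apply: dsumP => p /=; rewrite /path_mul_fun -big_split.
by apply: eq_bigr => i _; rewrite /= mulrDl.
Qed.
Fact path_mulDr : right_distributive path_mul +%R.
Proof.
move=> f g h; apply: dsumP => p /=; rewrite /path_mul_fun -big_split.
by apply: eq_bigr => i _; rewrite /= mulrDr.
Qed.
HB.instance Definition _ := GRing.Zmodule_isPzRing.Build path_alg
  path_mulA path_mul1 path_mulr1 path_mulDl path_mulDr.

Definition path_elt p : path_alg :=
  @dinj _ _ (fun _ : qpath => K^o : lmodType K) p (1 : K).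

Definition vertex_path x : qpath := exist path_pred (x, [::]) isT.
Fact arrow_path_subproof (a : arrow Q) : path_pred (src a, [:: a]).
Proof. by rewrite /path_pred /= eqxx. Qed.
Definition arrow_path a : qpath := exist path_pred _ (arrow_path_subproof a).

Definition ideal (I : path_alg -> Prop) :=
  [/\ I 0, forall f g, I f -> I g -> I (f + g) &
      forall h f, I f -> I (h * f) /\ I (f * h)].

(* the m-th power of the arrow ideal: the span of the paths of length >= m     *)
Definition arrow_ideal_pow (m : nat) f := forall p, f p != 0 -> (m <= plen p)%N.

Definition admissible (I : path_alg -> Prop) :=
  ideal I /\ exists m : nat, [/\ (2 <= m)%N,
    forall f, arrow_ideal_pow m f -> I f & forall f, I f -> arrow_ideal_pow 2 f].

Lemma path_eltE p q : path_elt p q = (p == q)%:R.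
Proof.
have [->|pq] := eqVneq p q; first exact: dinj_id.
exact: (@dinj_ne _ _ (fun _ : qpath => K^o : lmodType K)).
Qed.

Lemma path_elt_mul u v q : (sval q).1 = (sval v).1 ->
  (sval q).2 = (sval v).2 ++ (sval u).2 ->
  (sval u).1 = path_end (sval v).1 (sval v).2 ->
  path_elt u * path_elt v = path_elt q.
Proof.
move=> q1 q2 u1.
have qv : ptake (plen v) q = v.
  by apply: val_inj; rewrite /= q1 q2 take_size_cat //; case: (v) => -[].
have qu : pdrop (plen v) q = u.
  apply: val_inj; rewrite /= q1 q2 take_size_cat // drop_size_cat // -u1.
  by case: (u) => -[].
have vq : (plen v < (plen q).+1)%N by rewrite ltnS /plen q2 size_cat leq_addr.
apply: dsumP => p; rewrite path_eltE [LHS]/(path_mul_fun _ _ p).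
have [<-|qp] := eqVneq q p.
  rewrite (bigD1 (Ordinal vq)) // !path_eltE qv qu !eqxx mulr1 big1 => [|i iv].
    exact: addr0.
  rewrite !path_eltE; have [vi|_] := eqVneq v (ptake i q); last by rewrite mulr0.
  case/negP: iv; apply/eqP/val_inj; rewrite /= vi plen_take //.
  by rewrite -ltnS.
rewrite big1 // => i _; rewrite !path_eltE -natrM mulnb.
case: andP => // -[/eqP ui /eqP vi]; case/eqP: qp; apply: val_inj.
rewrite [LHS]surjective_pairing q1 q2 ui vi /= cat_take_drop.
by case: (sval p).
Qed.
End PathAlgebra.

Section Presentation.
Variables (K : fieldType) (A : basic_algebra K) (Q : quiver (vert A)).

(* A = KQ/I with I the kernel of [pres], and A_0 = Q_0 *)
Record presentation := Presentation {
  pres :> {rmorphism path_alg K Q -> A};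
  pres_scalable : scalable pres;
  pres_vertex : forall x, pres (path_elt K (vertex_path Q x)) = idem x;
  pres_surj : forall a : A, exists f, pres f = a;
  pres_admissible : admissible (fun f => pres f = 0) }.

Variable pi : presentation.

Fact arrow_class_subproof (a : arrow Q) :
  pi (path_elt K (arrow_path a)) \in @peirce K A (src a) (tgt a).
Proof.
apply/peirceP; rewrite -!(pres_vertex pi) -!rmorphM.
rewrite (@path_elt_mul _ _ _ _ _ (arrow_path a)) //.
by rewrite (@path_elt_mul _ _ _ _ _ (arrow_path a)).
Qed.
Definition arrow_class (a : arrow Q) : hom (alg_cat A) (src a) (tgt a) :=
  Subvs (arrow_class_subproof a).
End Presentation.

Section Walks.
Variables (V : finType) (Q : quiver V).

(* arrows of the double quiver: [inl a] is a, [inr a] is a^-1 *)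
Definition darrow := (arrow Q + arrow Q)%type.
Definition dsrc (l : darrow) := match l with inl a => src a | inr a => tgt a end.
Definition dtgt (l : darrow) := match l with inl a => tgt a | inr a => src a end.
Definition dinv (l : darrow) : darrow :=
  match l with inl a => inr a | inr a => inl a end.

(* The walk l_m ... l_1 is stored as [:: l_1; ...; l_m]. *)
Definition walk_inv (C : seq darrow) := rev (map dinv C).

Definition simple_cycle (C : seq darrow) :=
  [&& C != [::], cycle (fun l l' => dtgt l == dsrc l') C & uniq (map dsrc C)].

Definition equiv_cycle (C C' : seq darrow) :=
  size C = size C' /\
  exists c : nat, (1 <= c <= size C)%N /\ (rot c C = C' \/ rot c C = walk_inv C').

Definition cycle_representatives (S : set (seq darrow)) :=
  (forall C, S C -> simple_cycle C) /\
  forall C, simple_cycle C -> exists! C', S C' /\ equiv_cycle C C'.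

Definition walk_scalar (K : fieldType) (c : V -> V -> K) (C : seq darrow) : K :=
  \prod_(l <- C) match l with
                 | inl a => c (src a) (tgt a)
                 | inr a => (c (src a) (tgt a))^-1
                 end.
End Walks.

(* Main.v *)
Require Import Defs.
From HB Require Import structures.
From mathcomp Require Import all_boot all_order all_algebra all_field.
From mathcomp Require Import boolp classical_sets.
From mathcomp Require Import ring.
Import Defs.

Set Implicit Arguments.
Unset Strict Implicit.
Unset Printing Implicit Defensive.

Import GRing.Theory.
Local Open Scope ring_scope.

(** The point is that psi is a rescaling of phi: there are nonzero scalars v_p,
one for each object p of the repetitive category, such that
psi(f) = (v_q / v_p) phi(f) for every f : p -> q. Then the morphisms v_p^-1
form a natural isomorphism psi => phi, and composing with its iterates, which
are invertible, is an isomorphism between the orbit categories that is the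
identity on objects and respects degrees.

The scalars are found in three stages.

On the quiver, the factors c by which theta = phi_0^-1 psi_0 scales the arrows
multiply to 1 along every simple cycle. A closed walk that repeats a vertex
splits into two shorter closed walks, so the product is 1 along every closed
walk, and the product along a walk from a chosen root of its component gives
b_x with c = b_t / b_s on every arrow s -> t ([potential_of_cycles]). Paths span
the algebra, so theta(f) = (b_y / b_x) f for every f in A(x, y)
([path_functor_scales]).

The automorphism sigma = phi^-1 psi of the repetitive category fixes every
object and restricts to theta on one level, the one with index -n. Without
oriented cycles the space of morphisms from x^[i] to x^[i+1], which is D(A(x, x)),
is a line, so sigma acts on it by a nonzero scalar u_x. The pairing
A(x, y) x D(A(x, y)) -> k is read off from composites lying in such lines, and
sigma preserves composition. Hence, if sigma is the rescaling by b on level i,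
it must be the rescaling by u b on level i + 1 and by the ratio of the two on
the morphisms between these levels, and the same argument runs downwards
([level_next], [level_to_step]). Starting from level -n this reaches every
level ([level_propagation]), so sigma, and with it psi = phi sigma, is a
rescaling ([rescaled_of_zero_aut]).

Finally psi^k is the rescaling of phi^k by the product of v along k steps of the
phi-orbit ([apow_rescale]). These products satisfy the cocycle identity, which
is the condition on the family (eta_k)_k ([scalar_equivariant]). *)

(** * Rescaled functors *)

Section Rescale.
Variables (K : fieldType) (C D : lincat K).
Variables (F : linfunctor C D) (a : C -> K) (a0 : forall x, a x != 0).
Definition rescale_mor x y (f : hom C x y) : hom D (F x) (F y) :=
  (a y / a x) *: fmor F f.
Fact rescale_lin x y k (f g : hom C x y) :
  rescale_mor (k *: f + g) = k *: rescale_mor f + rescale_mor g.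
Proof. by rewrite /rescale_mor fmor_lin scalerDr !scalerA mulrC. Qed.
Fact rescale_id x : rescale_mor (idm C x) = idm D (F x).
Proof. by rewrite /rescale_mor fmor1 divff ?a0 // scale1r. Qed.
Fact rescale_comp x y z (g : hom C y z) (f : hom C x y) :
  rescale_mor (g \@ f) = rescale_mor g \@ rescale_mor f.
Proof.
by rewrite /rescale_mor fmorM compZl compZr scalerA mulrA divfK.
Qed.
Definition rescale : linfunctor C D :=
  @LinFunctor K C D F rescale_mor rescale_lin rescale_id rescale_comp.
End Rescale.

(** Functors that agree definitionally on objects can be compared on morphisms
without any transport along equalities of objects. *)
Lemma functor_eq_same_ob (K : fieldType) (C D : lincat K) (F : linfunctor C D)
    (m : forall x y, hom C x y -> hom D (F x) (F y)) l i c :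
  (forall x y (f : hom C x y), fmor F f = m x y f) ->
  F = @LinFunctor K C D F m l i c.
Proof.
move=> H; apply: (@linfunctorP _ _ _ F (LinFunctor l i c) (fun=> erefl)).
by move=> x y f; rewrite !eqm_id comp1m compm1 /= H.
Qed.

Section RescaleTheory.
Variables (K : fieldType) (C D E : lincat K).

Lemma rescale1 (F : linfunctor C D) (a : C -> K) (a0 : forall x, a x != 0) :
  (forall x, a x = 1) -> rescale F a0 = F.
Proof.
move=> a1; apply/esym/functor_eq_same_ob => x y f.
by rewrite /rescale_mor !a1 divr1 scale1r.
Qed.

Lemma rescale_ext (F : linfunctor C D) (a b : C -> K)
    (a0 : forall x, a x != 0) (b0 : forall x, b x != 0) :
  a =1 b -> rescale F a0 = rescale F b0.
Proof.
move=> ab; apply: (@functor_eq_same_ob _ _ _ (rescale F a0)) => x y f.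
by rewrite /= /rescale_mor !ab.
Qed.

Lemma compF_rescale (G : linfunctor D E) (F : linfunctor C D) (a : C -> K)
    (b : D -> K) (a0 : forall x, a x != 0) (b0 : forall x, b x != 0)
    (ba0 : forall x, b (F x) * a x != 0) :
  compF (rescale G b0) (rescale F a0) = rescale (compF G F) ba0.
Proof.
apply: (@functor_eq_same_ob _ _ _ (compF (rescale G b0) (rescale F a0))) => x y f.
by rewrite /= /rescale_mor /= fmorZ scalerA invfM mulrACA.
Qed.
End RescaleTheory.

Section Straighten.
Variables (K : fieldType) (C : lincat K) (F : linfunctor C C).
Variable e : forall x, F x = x.
Definition straight_mor x y (f : hom C x y) : hom C x y :=
  eqm (e y) \@ fmor F f \@ eqm (esym (e x)).
Fact straight_lin x y k (f g : hom C x y) :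
  straight_mor (k *: f + g) = k *: straight_mor f + straight_mor g.
Proof. by rewrite /straight_mor fmor_lin comp_linr comp_linl. Qed.
Fact straight_id x : straight_mor (idm C x) = idm C x.
Proof. by rewrite /straight_mor fmor1 compm1 eqm_comp eqm_id. Qed.
Fact straight_comp x y z (g : hom C y z) (f : hom C x y) :
  straight_mor (g \@ f) = straight_mor g \@ straight_mor f.
Proof.
rewrite /straight_mor fmorM !compA -(compA _ (eqm (esym (e y)))) eqm_comp eqm_id.
by rewrite compm1.
Qed.
(** The action on objects is literally the identity, so the value at an element of
hom C x y can be compared with elements of the same hom C x y. *)
Definition straighten : linfunctor C C :=
  @LinFunctor K C C id straight_mor straight_lin straight_id straight_comp.
Lemma straightenE : F = straighten.
Proof.
apply: (@linfunctorP _ _ _ F straighten e) => x y f.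
by rewrite /= /straight_mor -compA eqm_comp eqm_id compm1.
Qed.
End Straighten.

(** * Scalar natural isomorphisms between powers of automorphisms *)

Section IntProd.
Variable K : fieldType.

(** The product of u over the integers from 0 to k - 1, extended to negative k in
the one way that makes the recursion [zprodS] hold for every k. *)
Definition zprod (u : int -> K) (k : int) : K :=
  match k with
  | Posz m => \prod_(j < m) u j
  | Negz m => (\prod_(j < m.+1) u (Negz j))^-1
  end.

Lemma zprod0 u : zprod u 0 = 1.
Proof. by rewrite /= big_ord0. Qed.

Lemma zprod_neq0 u k : (forall j, u j != 0) -> zprod u k != 0.
Proof. by move=> u0; case: k => m; rewrite /= ?invr_eq0; apply/prodf_neq0. Qed.

Lemma zprodS u k : (forall j, u j != 0) -> zprod u (1 + k) = u k * zprod u k.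
Proof.
move=> u0; case: k => [m|[|m]].
- by rewrite -PoszD /= big_ord_recr mulrC.
- by rewrite /= big_ord0 big_ord1 divff.
have -> : 1 + Negz m.+1 = Negz m by rewrite !NegzE -[m.+2]addn1; ring.
by rewrite /= [in RHS]big_ord_recr /= invfM mulrCA divff ?mulr1.
Qed.

End IntProd.

Section RescalePowers.
Variables (K : fieldType) (C : lincat K) (h g : autom C).
Variables (a : C -> K) (a0 : forall x, a x != 0).
Hypothesis hg : autf h = rescale g a0.

Definition cocycle k x := zprod (fun j => a (apow g j x)) k.

Lemma cocycle_neq0 k x : cocycle k x != 0.
Proof. exact: zprod_neq0. Qed.

Lemma cocycleS k x : cocycle (1 + k) x = a (apow g k x) * cocycle k x.
Proof. exact: zprodS. Qed.

Lemma cocycleD k l x : cocycle (k + l) x = cocycle k (apow g l x) * cocycle l x.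
Proof.
have ob j : apow g j (apow g l x) = apow g (j + l) x by rewrite apowD.
elim/int_ind: k => [|m IH|m IH]; first by rewrite add0r /cocycle zprod0 mul1r.
  by rewrite -addn1 addnC PoszD -addrA !cocycleS ob IH mulrA.
have e : - m%:Z = 1 + (- m.+1%:Z) by rewrite -addn1 PoszD; ring.
move: IH; rewrite {1 2}e -addrA !cocycleS ob -mulrA.
by apply: mulfI.
Qed.

(** For negative k the step is undone by cancelling the automorphism h. *)
Lemma apow_rescale k : apow h k = rescale (apow g k) (cocycle_neq0 k).
Proof.
have S j : compF h (rescale (apow g j) (cocycle_neq0 j)) =
    rescale (apow g (1 + j)) (cocycle_neq0 (1 + j)).
  rewrite hg (@compF_rescale _ _ _ _ g _ _ _ (cocycle_neq0 j) a0 (fun x =>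
    mulf_neq0 (a0 (apow g j x)) (cocycle_neq0 j x))).
  move: (cocycle_neq0 (1 + j)); rewrite apowS => n0.
  by apply: rescale_ext => x; rewrite cocycleS.
elim/int_ind: k => [|m IH|m IH].
- by rewrite rescale1 // => x; apply: zprod0.
- by rewrite -addn1 addnC PoszD apowS IH S.
have e : - m%:Z = 1 + (- m.+1%:Z) by rewrite -addn1 PoszD; ring.
by move: IH; rewrite e apowS -S => /(congr1 (compF (autinv h))); rewrite !compFA autK !comp1F.
Qed.

Lemma apow_rescale_ob k x : apow h k x = apow g k x.
Proof. by rewrite apow_rescale. Qed.

Definition scalar_iso k x : hom C (apow h k x) (apow g k x) :=
  (cocycle k x)^-1 *: eqm (apow_rescale_ob k x).

Fact scalar_iso_natural k x y (f : hom C x y) :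
  scalar_iso k y \@ fmor (apow h k) f = fmor (apow g k) f \@ scalar_iso k x.
Proof.
rewrite /scalar_iso compZl compZr.
have := linfunctor_congr (apow_rescale k) f.
rewrite (eqm_irr _ (apow_rescale_ob k x)) (eqm_irr _ (apow_rescale_ob k y)) => ->.
rewrite /= /rescale_mor compZl scalerA; congr (_ *: _).
by rewrite mulrA mulVf ?cocycle_neq0 // mul1r.
Qed.
Definition scalar_nat k : nattrans (apow h k) (apow g k) :=
  NatTrans (@scalar_iso_natural k).

Lemma scalar_nat_iso k : is_natiso (scalar_nat k).
Proof.
move=> x; exists (cocycle k x *: eqm (esym (apow_rescale_ob k x))).
rewrite /= /scalar_iso !compZl !compZr !scalerA !eqm_comp !eqm_id.
by rewrite divff ?mulVf ?cocycle_neq0 // !scale1r.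
Qed.

Lemma scalar_natD k l x :
  eqm (apow_ob g erefl x) \@ scalar_nat (k + l) x =
    scalar_nat k (apow g l x) \@ fmor (apow h k) (scalar_nat l x) \@
    eqm (apow_ob h erefl x).
Proof.
rewrite /= /scalar_iso fmorZ fmor_eqm !compZl !compZr !compZl scalerA cocycleD invfM.
congr (_ *: _).
by rewrite !eqm_comp; apply: eqm_irr.
Qed.

Definition scalar_equivariant : equivariant h g :=
  Equivariant scalar_nat_iso scalar_natD.
End RescalePowers.

(** * Orbit functors are invertible *)

Section GrIso.
Variable K : fieldType.

Lemma homog_eqm (A : grcat K) (x y : A) (e : x = y) : homog A 0 (eqm e).
Proof. by subst y; apply: homog_id. Qed.

Definition eq_nat (C D : lincat K) (F G : linfunctor C D) (e : F = G) : nattrans F G :=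
  NatTrans (fun x y f => linfunctor_congr e f).

Lemma gr2iso_eq (A B : grcat K) (F G : dpfunctor B A) :
  dpf F = dpf G -> dpr F =1 dpr G -> gr2iso F G.
Proof.
move=> e r.
have P (F' G' : dpfunctor B A) (e' : dpf F' = dpf G') (r' : dpr F' =1 dpr G') x :
    homog A (dpr F' x - dpr G' x) (eq_nat e' x).
  by rewrite r' subrr; apply: homog_eqm.
exists (Gr2Mor (P _ _ e r)), (Gr2Mor (P _ _ (esym e) (fsym r))) => x /=.
by rewrite !eqm_comp !eqm_id.
Qed.

Lemma strict_gr_equivalence (A B : grcat K) (F : dpfunctor B A) (G : dpfunctor A B) :
  compF G F = idF B -> compF F G = idF A ->
  (forall x, dpr F x = 0) -> (forall y, dpr G y = 0) -> gr_equivalence F.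
Proof.
by move=> GF FG rF rG; exists G; split; apply: gr2iso_eq => //= x; rewrite rF rG.
Qed.
End GrIso.

Section OrbitIso.
Variables (K : fieldType) (C : lincat K) (h g : autom C).
Variables (eta : equivariant h g) (eta' : equivariant g h).
Hypothesis etaK : forall k x, eta k x \@ eta' k x = idm C (apow g k x).

Lemma orbit_morK x y : cancel (@orbit_mor _ _ _ _ eta x y) (@orbit_mor _ _ _ _ eta' x y).
Proof. by move=> f; apply: dsumP => k /=; rewrite -compA etaK compm1. Qed.

Lemma orbit_functorK : compF (orbit_functor eta') (orbit_functor eta) = idF (orbit_grcat g).
Proof.
by apply/esym/(@functor_eq_same_ob _ _ _ (idF _)) => x y f /=; rewrite orbit_morK.
Qed.

Lemma orbit_functor_onK (P : C -> Prop) :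
  compF (orbit_functor_on eta' P) (orbit_functor_on eta P) =
    idF (fullsub (P : orbit_grcat g -> Prop)).
Proof.
have e x : compF (orbit_functor_on eta' P) (orbit_functor_on eta P) x = x.
  by case: x => x Px; congr exist; apply: Prop_irrelevance.
apply: (@linfunctorP _ _ _ (compF (orbit_functor_on eta' P) (orbit_functor_on eta P))
  (idF _) e) => -[x Px] [y Py] f.
(* The transports are identities of the ambient category, up to the irrelevant
   proofs of membership. *)
have E (u v : fullsub (P : orbit_grcat g -> Prop)) (uv : u = v) :
    eqm uv = @eqm _ (orbit_grcat g) _ _ (congr1 sval uv) by subst v.
rewrite !E !(@eqm_id _ (orbit_grcat g)).
rewrite [LHS](@comp1m _ (orbit_grcat g)) [RHS](@compm1 _ (orbit_grcat g)).
exact: orbit_morK.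
Qed.
End OrbitIso.

Section EquivariantInverse.
Variables (K : fieldType) (C : lincat K) (h g : autom C) (eta : equivariant h g).

Definition eqv_inv_mor k x : hom C (apow g k x) (apow h k x) :=
  sval (cid (eqv_iso eta k x)).

Lemma eqv_invK k x : eqv_inv_mor k x \@ eta k x = idm C (apow h k x).
Proof. by rewrite /eqv_inv_mor; case: cid => f []. Qed.

Lemma eqv_invKV k x : eta k x \@ eqv_inv_mor k x = idm C (apow g k x).
Proof. by rewrite /eqv_inv_mor; case: cid => f []. Qed.

Fact eqv_inv_natural k x y (f : hom C x y) :
  eqv_inv_mor k y \@ fmor (apow g k) f = fmor (apow h k) f \@ eqv_inv_mor k x.
Proof.
rewrite -[LHS]compm1 -(eqv_invKV k x) compA -(compA _ _ (eta k x)).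
by rewrite -ntcP compA eqv_invK comp1m.
Qed.
Definition eqv_inv_nat k : nattrans (apow g k) (apow h k) :=
  NatTrans (@eqv_inv_natural k).

Fact eqv_inv_iso k : is_natiso (eqv_inv_nat k).
Proof. by move=> x; exists (eta k x); rewrite eqv_invK eqv_invKV. Qed.

(** The cocycle identity of eta read backwards, after the two factors are commuted
by naturality. *)
Fact eqv_invD k l x :
  eqm (apow_ob h erefl x) \@ eqv_inv_nat (k + l) x =
    eqv_inv_nat k (apow h l x) \@ fmor (apow g k) (eqv_inv_nat l x) \@
    eqm (apow_ob g erefl x).
Proof.
rewrite ntcP -[RHS]compm1 -(eqv_invKV (k + l) x) [RHS]compA.
rewrite -(compA _ _ (eta (k + l) x)) eqvD !compA -(compA _ _ (eta k _)) eqv_invK.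
by rewrite compm1 -fmorM eqv_invK fmor1 comp1m.
Qed.

Definition eqv_inv : equivariant g h := Equivariant eqv_inv_iso eqv_invD.
End EquivariantInverse.

Section OrbitEquivalence.
Variables (K : fieldType) (C : lincat K) (h g : autom C) (eta : equivariant h g).

Lemma orbit_functor_equivalence : gr_equivalence (orbit_functor eta).
Proof.
apply: (@strict_gr_equivalence _ _ _ _ (orbit_functor (eqv_inv eta))) => //.
  exact: (@orbit_functorK _ _ _ _ eta (eqv_inv eta) (eqv_invKV eta)).
exact: (@orbit_functorK _ _ _ _ (eqv_inv eta) eta (eqv_invK eta)).
Qed.

Lemma orbit_functor_on_equivalence (P : C -> Prop) :
  gr_equivalence (orbit_functor_on eta P) /\ gr_isomorphism (orbit_functor_on eta P).
Proof.
have GF := orbit_functor_onK (eta' := eqv_inv eta) (eqv_invKV eta) P.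
have FG := orbit_functor_onK (eta := eqv_inv eta) (eta' := eta) (eqv_invK eta) P.
split; last by exists (orbit_functor_on (eqv_inv eta) P).
exact: (@strict_gr_equivalence _ _ _ _ (orbit_functor_on (eqv_inv eta) P)).
Qed.
End OrbitEquivalence.

(** * A potential for the scalars on the quiver *)

Section Potential.
Variables (K : fieldType) (V : finType) (Q : quiver V) (c : V -> V -> K).
Hypothesis c0 : forall a : arrow Q, c (src a) (tgt a) != 0.
Local Notation ws := (@walk_scalar V Q K c).

Lemma walk_scalar_cons l (C : seq (darrow Q)) : ws (l :: C) = ws [:: l] * ws C.
Proof. by rewrite /walk_scalar big_cons big_seq1. Qed.

Lemma walk_scalar_cat (C D : seq (darrow Q)) : ws (C ++ D) = ws C * ws D.
Proof. by rewrite /walk_scalar big_cat. Qed.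

Lemma walk_scalar_inv (C : seq (darrow Q)) : ws (walk_inv C) = (ws C)^-1.
Proof.
elim: C => [|l C IH]; first by rewrite /walk_scalar !big_nil invr1.
rewrite /walk_inv map_cons rev_cons -cats1 walk_scalar_cat IH [in RHS]walk_scalar_cons.
rewrite invfM mulrC; congr (_ * _).
by rewrite /walk_scalar !big_seq1; case: l => a //=; rewrite invrK.
Qed.

Lemma walk_scalar_rot m (C : seq (darrow Q)) : ws (rot m C) = ws C.
Proof. by rewrite /rot walk_scalar_cat mulrC -walk_scalar_cat cat_take_drop. Qed.

Lemma walk_scalar_neq0 (C : seq (darrow Q)) : ws C != 0.
Proof.
by rewrite /walk_scalar prodf_seq_neq0; apply/allP => -[] a _; rewrite /= ?invr_eq0.
Qed.

Lemma simple_cycle_scalar (S : set (seq (darrow Q))) :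
  cycle_representatives S -> (forall C, S C -> ws C = 1) ->
  forall C, simple_cycle C -> ws C = 1.
Proof.
move=> [_ repS] S1 C /repS[C' [[SC' [_ [m [_ eC]]]] _]].
rewrite -(walk_scalar_rot m); case: eC => ->; first exact: S1.
by rewrite walk_scalar_inv S1 // invr1.
Qed.

Fixpoint walk (x y : V) (C : seq (darrow Q)) : bool :=
  if C is l :: C' then (dsrc l == x) && walk (dtgt l) y C' else x == y.

Lemma walk_cat x z (C D : seq (darrow Q)) :
  reflect (exists2 y, walk x y C & walk y z D) (walk x z (C ++ D)).
Proof.
elim: C x => [|l C IH] x /=.
  apply: (iffP idP) => [w|[y /eqP -> //]]; by exists x.
apply: (iffP andP) => [[sl /IH[y w w']]|[y /andP[sl w] w']].
  by exists y; rewrite ?sl.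
by split=> //; apply/IH; exists y.
Qed.

Lemma walk_invP x y (C : seq (darrow Q)) : walk x y C -> walk y x (walk_inv C).
Proof.
elim: C x => [|l C IH] x /=; first by rewrite eq_sym.
move=> /andP[/eqP sl /IH w]; rewrite /walk_inv map_cons rev_cons -cats1.
apply/walk_cat; exists (dtgt l) => //=.
by case: l sl {w} => a /= ->; rewrite !eqxx.
Qed.

Lemma walk_cycle x l (C : seq (darrow Q)) :
  walk x x (l :: C) -> cycle (fun l l' => dtgt l == dsrc l') (l :: C).
Proof.
move=> /= /andP[/eqP sl]; rewrite -sl.
set P := path _; suff: forall k, walk (dtgt k) (dsrc l) C -> P k (rcons C l) by apply.
elim: C => [|m C IH] k /=; first by rewrite andbT.
by move=> /andP[/eqP -> /IH ->]; rewrite eqxx.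
Qed.

(** A closed walk with a repeated source vertex splits at the repetition into two
shorter closed walks. *)
Lemma closed_walk_scalar : (forall C : seq (darrow Q), simple_cycle C -> ws C = 1) ->
  forall x C, walk x x C -> ws C = 1.
Proof.
move=> c1 x C; have [m] := ubnP (size C); elim: m x C => // m IH x C.
rewrite ltnS => Cm w; have [uC|] := boolP (uniq (map (@dsrc _ Q) C)).
  case: C {Cm} w uC => [|l C] w uC; first by rewrite /walk_scalar big_nil.
  by apply: c1; rewrite /simple_cycle uC (walk_cycle w).
have split_src y (D : seq (darrow Q)) : y \in map (@dsrc _ Q) D ->
    exists D1 l D2, D = D1 ++ l :: D2 /\ dsrc l = y.
  by case/mapP => l /splitPr[D1 D2] ->; exists D1, l, D2.
suff: forall D, ~~ uniq (map (@dsrc _ Q) D) -> exists D1 l D2 k D3,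
    [/\ D = D1 ++ (l :: D2) ++ (k :: D3) & dsrc l = dsrc k].
  move=> /[apply] -[D1 [l [D2 [k [D3 [eC lk]]]]]].
  move: w Cm; rewrite eC => /walk_cat[y w1 /walk_cat[z w2 w3]].
  have yz : y = z by move: w2 w3 => /= /andP[/eqP <- _] /andP[/eqP <- _].
  subst z; rewrite !size_cat => lm; rewrite !walk_scalar_cat (IH y (l :: D2)) //; last first.
    by apply: leq_trans lm; rewrite /= addnCA -{1}[(size D2).+1]addn0 ltn_add2l addnS.
  rewrite mul1r -walk_scalar_cat (IH x) //; last by apply/walk_cat; exists y.
  rewrite size_cat; apply: leq_trans lm.
  by rewrite addSn addnS ltnS leq_add2l leq_addl.
elim=> //= l D IHD; rewrite negb_and negbK => /orP[/split_src|/IHD].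
  by case=> D2 [k [D3 [-> kl]]]; exists [::], l, D2, k, D3.
by case=> D1 [l' [D2 [k [D3 [-> e]]]]]; exists (l :: D1), l', D2, k, D3.
Qed.

(** The potential at x is the scalar of a walk to x from a fixed root of its
connected component. The walk to s(a), the arrow a, and the walk to t(a) run
backwards form a closed walk, which gives the value on a. *)
Lemma potential_of_cycles : (forall C : seq (darrow Q), simple_cycle C -> ws C = 1) ->
  exists2 b : V -> K, (forall x, b x != 0) &
    forall a : arrow Q, c (src a) (tgt a) = b (tgt a) / b (src a).
Proof.
move=> /closed_walk_scalar c1.
pose conn x : pred V := fun r => `[< exists C, walk r x C >].
pose root x := odflt x [pick r | conn x r].
have /choice[W hW] x : exists C, walk (root x) x C.
  rewrite /root; case: pickP => [r /asboolP //|/(_ x)/asboolP[]].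
  by exists [::] => /=.
have rootE x y C : walk x y C -> root x = root y.
  move=> w; have e : conn x =1 conn y.
    move=> r; apply/asboolP/asboolP => -[D wD].
      by exists (D ++ C); apply/walk_cat; exists x.
    by exists (D ++ walk_inv C); apply/walk_cat; exists y; last exact: walk_invP.
  rewrite /root (eq_pick e); case: pickP => // /(_ y)/asboolP[].
  by exists [::] => /=.
exists (fun x => ws (W x)) => [x|a]; first exact: walk_scalar_neq0.
have wa : walk (src a) (tgt a) [:: inl a : darrow Q] by rewrite /= !eqxx.
have : walk (root (src a)) (root (src a))
    (W (src a) ++ [:: inl a : darrow Q] ++ walk_inv (W (tgt a))).
  apply/walk_cat; exists (src a) => //; apply/walk_cat; exists (tgt a) => //.
  by rewrite (rootE _ _ _ wa); apply: walk_invP.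
move/c1; rewrite !walk_scalar_cat walk_scalar_inv {2}/walk_scalar big_seq1 => e.
apply: (mulIf (walk_scalar_neq0 (W (src a)))); rewrite divfK ?walk_scalar_neq0 //.
by rewrite -[RHS]mul1r -e -mulrA divfK ?walk_scalar_neq0 // mulrC.
Qed.
End Potential.

(** * From arrows to the whole algebra *)

Section PathSpan.
Variables (K : fieldType) (A : basic_algebra K) (Q : quiver (vert A)).
Variable pi : presentation Q.
Variables (F : linfunctor (alg_cat A) (alg_cat A)).
Variables (b : vert A -> K) (b0 : forall x, b x != 0).
Hypothesis Fob : forall x, F x = x.
Hypothesis Farrow : forall a : arrow Q, vsval (fmor F (arrow_class pi a)) =
  (b (tgt a) / b (src a)) *: vsval (arrow_class pi a).
Local Notation e := (@idem K A).

(** Morphisms of [alg_cat] are elements of A together with a membership proof;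
stating the property for an element u avoids fixing that proof. *)
Definition scales x y (u : A) := forall f : hom (alg_cat A) x y,
  vsval f = u -> vsval (fmor F f) = (b y / b x) *: u.

Lemma scales_hom x y (f : hom (alg_cat A) x y) :
  vsval (fmor F f) = (b y / b x) *: vsval f -> scales x y (vsval f).
Proof. by move=> Ff g /val_inj ->. Qed.

Definition psrc (p : qpath Q) := (sval p).1.
Definition ptgt (p : qpath Q) := path_end (psrc p) (sval p).2.

Lemma path_class_peirce (p : qpath Q) :
  pi (path_elt K p) \in @peirce K A (psrc p) (ptgt p).
Proof.
apply/peirceP; rewrite -!(pres_vertex pi) -!rmorphM.
by rewrite !(@path_elt_mul _ _ _ _ _ p) //= cats0.
Qed.

Lemma scales_path (p : qpath Q) : scales (psrc p) (ptgt p) (pi (path_elt K p)).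
Proof.
case: p => -[x w] p; rewrite /ptgt /psrc /=.
elim: w x p => [|a w IH] x p.
  have -> : pi (path_elt K (exist (@path_pred _ Q) _ p)) = vsval (idm (alg_cat A) x).
    rewrite -[RHS](pres_vertex pi); congr (pi (path_elt _ _)); exact: val_inj.
  apply: scales_hom; rewrite fmor1 divff ?scale1r //.
  by rewrite -[LHS]/(e (F x)) Fob.
have /andP[/= /eqP sa p'] := p; subst x.
pose q : qpath Q := exist (@path_pred _ Q) (tgt a, w) p'.
pose fq : hom (alg_cat A) (psrc q) (ptgt q) := Subvs (path_class_peirce q).
rewrite -(@path_elt_mul _ _ _ q (arrow_path a)) // rmorphM.
rewrite -[pi _ * _]/(vsval (fq \@ arrow_class pi a)).
apply: scales_hom; rewrite fmorM /= Farrow (IH _ p') //= -scalerAl -scalerAr scalerA.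
by rewrite mulrA divfK.
Qed.

Lemma path_functor_scales x y (f : hom (alg_cat A) x y) :
  vsval (fmor F f) = (b y / b x) *: vsval f.
Proof.
have [g gf] := pres_surj pi (vsval f).
have [s us gs] := dsum_supp g.
have gE : g = \sum_(p <- s) g p *: path_elt K p.
  rewrite {1}(dsum_dinjE us gs); apply: eq_bigr => p _; apply: dsumP => q.
  rewrite dsumZE path_eltE; have [<-|pq] := eqVneq p q.
    by rewrite dinj_id /=; apply/esym/mulr1.
  by rewrite dinj_ne //; apply/esym/mulr0.
(* Cutting a combination of paths down by the idempotents of x and y leaves f
   unchanged and puts each term in A(x, y). *)
have mem p : e y * pi (path_elt K p) * e x \in @peirce K A x y.
  by apply/peirceP; rewrite !mulrA idem_id -!mulrA idem_id.
have [h hE] : exists h : qpath Q -> hom (alg_cat A) x y,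
    forall p, vsval (h p) = e y * pi (path_elt K p) * e x.
  by exists (fun p => Subvs (mem p)).
have fE : f = \sum_(p <- s) g p *: h p.
  apply: val_inj; have /peirceP fP := subvsP f.
  rewrite -[LHS]/(vsval f) -fP -gf {1}gE rmorph_sum /=.
  rewrite mulr_sumr mulr_suml raddf_sum /=; apply: eq_bigr => p _.
  by rewrite hE (pres_scalable pi) /= -scalerAr -scalerAl.
rewrite fE fmor_sum [LHS]raddf_sum [in RHS]raddf_sum scaler_sumr.
apply: eq_bigr => p _; rewrite fmorZ !linearZ /=.
congr (_ *: _); have /peirceP eE := path_class_peirce p.
(* A path contributes to A(x, y) only if it runs from x to y. *)
have [px|npx] := eqVneq (psrc p) x; last first.
  have h0 : h p = 0.
    by apply: val_inj; rewrite [LHS]hE -eE -!mulrA (idem_orth npx) !mulr0.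
  by rewrite h0 fmor0 !linear0.
have [py|npy] := eqVneq y (ptgt p); last first.
  have h0 : h p = 0.
    by apply: val_inj; rewrite [LHS]hE -eE !mulrA (idem_orth npy) !mul0r.
  by rewrite h0 fmor0 !linear0.
have hp : vsval (h p) = pi (path_elt K p) by rewrite hE -px py.
by move: (h p) hp; rewrite -px py => k kp; rewrite kp; apply: scales_path.
Qed.
End PathSpan.

(** * Propagation along the levels of the repetitive category *)

Lemma dual_separates (K : fieldType) (V : vectType K) (v w : V) :
  (forall b : 'Hom(V, K^o), b v = b w) -> v = w.
Proof.
move=> H; rewrite (coord_vbasis (memvf v)) (coord_vbasis (memvf w)).
apply: eq_bigr => i _; congr (_ *: _).
have := H (linfun (coord (vbasis fullv) i : V -> K^o)); rewrite !lfunE; exact.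
Qed.

Section Levels.
Variables (K : fieldType) (A : basic_algebra K).
Local Notation Ahat := (repcat A).

Lemma rep_homP p q (f g : @rep_hom K A p q) :
  (rep_val f).1 = (rep_val g).1 -> (rep_val f).2 = (rep_val g).2 -> f = g.
Proof.
by move=> e1 e2; apply: rep_val_inj; rewrite [LHS]surjective_pairing e1 e2 -surjective_pairing.
Qed.

Lemma next_neq (i : int) : (i + 1 == i) = false.
Proof. by rewrite -subr_eq0 addrAC subrr add0r oner_eq0. Qed.

Lemma same_level_dual p q (g : rep_hom p q) : q.2 = p.2 -> (@rep_val K A p q g).2 = 0.
Proof.
move=> qp; have /andP[_ /orP[/eqP //|]] := rep_valP g.
by rewrite qp eq_sym next_neq.
Qed.

Lemma next_level_alg p q (g : rep_hom p q) : q.2 = p.2 + 1 -> (@rep_val K A p q g).1 = 0.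
Proof.
move=> qp; have /andP[+ _] := rep_valP g; rewrite qp next_neq orbF.
by move/eqP.
Qed.

(** The form beta |-> beta(1) on D(A(x, x)); it plays the role of the symmetrizing
form of a trivial extension algebra. *)
Definition rep_trace x (i j : int) (w : hom Ahat (x, i) (x, j)) : K :=
  (rep_val w).2 (alg_id x).

(** The right-hand side is symmetric in the two factors, so the same pairing of A
with DA is computed by composites in either order. *)
Lemma rep_trace_comp x y (i j k : int) (w : hom Ahat (y, j) (x, k))
    (g : hom Ahat (x, i) (y, j)) :
  rep_trace (w \@ g) = (rep_val g).2 (rep_val w).1 + (rep_val w).2 (rep_val g).1.
Proof.
rewrite /rep_trace /= /rep_comp_val /= add_lfunE dual_postcompE dual_precompE.
by rewrite alg_comp1m alg_compm1.
Qed.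

Lemma rep_traceZ x (i j : int) k (w : hom Ahat (x, i) (x, j)) :
  rep_trace (k *: w) = k * rep_trace w.
Proof. by rewrite /rep_trace /= scale_lfunE. Qed.

Variable S : forall p q, hom Ahat p q -> hom Ahat p q.
Hypothesis SZ : forall p q k (f : hom Ahat p q), S (k *: f) = k *: S f.
Hypothesis SM : forall p q r (g : hom Ahat q r) (f : hom Ahat p q),
  S (g \@ f) = S g \@ S f.
Hypothesis S_inj : forall p q (f : hom Ahat p q), S f = 0 -> f = 0.

Definition level_scaled (i : int) (b : vert A -> K) :=
  forall x y (g : hom Ahat (x, i) (y, i)), S g = (b y / b x) *: g.

Definition step_scaled (i : int) (b' b : vert A -> K) :=
  forall x y (w : hom Ahat (y, i) (x, i + 1)), S w = (b' x / b y) *: w.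

(** The four separation lemmas express that the pairing [rep_trace_comp] is
nondegenerate: a morphism is determined by the traces of its composites. *)
Lemma level_eq x y (i : int) (g g' : hom Ahat (x, i) (y, i)) :
  (forall w : hom Ahat (y, i) (x, i + 1), rep_trace (w \@ g) = rep_trace (w \@ g')) ->
  g = g'.
Proof.
move=> H; apply: rep_homP; last by rewrite !same_level_dual.
apply: dual_separates => be.
have bP : (0, be) \in @rep_pred K A (y, i) (x, i + 1).
  by rewrite unfold_in /rep_pred /= !eqxx orbT.
have := H (RepHom bP); rewrite !rep_trace_comp /=.
by rewrite !linear0 !add0r.
Qed.

Lemma level_eq_next x y (i : int) (g g' : hom Ahat (x, i + 1) (y, i + 1)) :
  (forall w : hom Ahat (y, i) (x, i + 1), rep_trace (g \@ w) = rep_trace (g' \@ w)) ->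
  g = g'.
Proof.
move=> H; apply: rep_homP; last by rewrite !same_level_dual.
apply: dual_separates => be.
have bP : (0, be) \in @rep_pred K A (y, i) (x, i + 1).
  by rewrite unfold_in /rep_pred /= !eqxx orbT.
have := H (RepHom bP); rewrite !rep_trace_comp /=.
by rewrite !linear0 !addr0.
Qed.

Lemma step_eq x y (i : int) (w w' : hom Ahat (y, i) (x, i + 1)) :
  (forall g : hom Ahat (x, i) (y, i), rep_trace (w \@ g) = rep_trace (w' \@ g)) ->
  w = w'.
Proof.
move=> H; apply: rep_homP; first by rewrite !next_level_alg.
apply/lfunP => f; have := H (emb_mor i f); rewrite !rep_trace_comp /=.
by rewrite !zero_lfunE !add0r.
Qed.

Lemma step_eq_next x y (i : int) (w w' : hom Ahat (y, i) (x, i + 1)) :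
  (forall g : hom Ahat (x, i + 1) (y, i + 1), rep_trace (g \@ w) = rep_trace (g \@ w')) ->
  w = w'.
Proof.
move=> H; apply: rep_homP; first by rewrite !next_level_alg.
apply/lfunP => f; have := H (emb_mor (i + 1) f); rewrite !rep_trace_comp /=.
by rewrite !zero_lfunE !addr0.
Qed.

Hypothesis hA : no_nonzero_oriented_cycles A.

Lemma rep_trace_eq0 x (i : int) (w : hom Ahat (x, i) (x, i + 1)) :
  rep_trace w = 0 -> w = 0.
Proof.
move=> w0; apply: rep_homP; first by rewrite next_level_alg.
apply/lfunP => f; have := subvsP f; rewrite {2}hA => /vlineP[k fk].
have -> : f = k *: alg_id x by apply: val_inj; rewrite /= -fk.
by rewrite linearZ /= [X in _ *: X]w0 scaler0 zero_lfunE.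
Qed.

(** Without oriented cycles these morphisms form a line, spanned by any om != 0. *)
Lemma socle_scalar x (i : int) : exists2 u : K, u != 0 &
  forall w : hom Ahat (x, i) (x, i + 1), S w = u *: w.
Proof.
have [om om0] := @rep_hom_next K A x i.
pose om' : hom Ahat (x, i) (x, i + 1) := om.
have t0 : rep_trace om' != 0 by apply: contraNneq om0 => /rep_trace_eq0 /eqP.
have E (w : hom Ahat (x, i) (x, i + 1)) : w = (rep_trace w / rep_trace om') *: om'.
  apply/eqP; rewrite -subr_eq0; apply/eqP/rep_trace_eq0.
  have -> (w1 w2 : hom Ahat (x, i) (x, i + 1)) :
      rep_trace (w1 - w2) = rep_trace w1 - rep_trace w2.
    by rewrite /rep_trace /= add_lfunE opp_lfunE.
  by rewrite rep_traceZ divfK // subrr.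
exists (rep_trace (S om') / rep_trace om').
  rewrite mulf_neq0 ?invr_eq0 //; apply: contraNneq om0 => /rep_trace_eq0/S_inj e.
  by apply/eqP.
move=> w; have := SZ (rep_trace w / rep_trace om') om'; rewrite -E => ->.
rewrite {1}(E (S om')) scalerA [_ / _ * (_ / _)]mulrC.
by rewrite -[LHS]scalerA -E.
Qed.

Section Step.
Variables (i : int) (u b : vert A -> K).
Hypotheses (u0 : forall x, u x != 0) (b0 : forall x, b x != 0).
Hypothesis Su : forall x (w : hom Ahat (x, i) (x, i + 1)), S w = u x *: w.
Let b' x := u x * b x.
Let b'0 x : b' x != 0. Proof. exact: mulf_neq0. Qed.

(* In both equivalences, comparing S (w g) = S w S g with the scalar by which S acts
   on the line that contains the composite yields the factor of one of w, g from
   the factor of the other. *)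
Let level_step : level_scaled i b <-> step_scaled i b' b.
Proof.
have H x y (w : hom Ahat (y, i) (x, i + 1)) (g : hom Ahat (x, i) (y, i)) :
  rep_trace (S w \@ S g) = u x * rep_trace (w \@ g) by rewrite -SM Su rep_traceZ.
split=> L x y w.
  apply: step_eq => g; have := H _ _ w g; rewrite L compZr compZl !rep_traceZ => e.
  have n0 : b y / b x != 0 by rewrite mulf_neq0 ?invr_eq0.
  by apply: (mulfI n0); rewrite e mulrA /b'; congr (_ * _); field; rewrite !b0.
apply: level_eq => g; have := H _ _ g w; rewrite L compZr compZl !rep_traceZ => e.
have n0 : b' x / b y != 0 by rewrite mulf_neq0 ?invr_eq0.
by apply: (mulfI n0); rewrite e mulrA /b'; congr (_ * _); field; rewrite !b0.
Qed.

Let step_level : step_scaled i b' b <-> level_scaled (i + 1) b'.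
Proof.
have H x y (w : hom Ahat (y, i) (x, i + 1)) (g : hom Ahat (x, i + 1) (y, i + 1)) :
  rep_trace (S g \@ S w) = u y * rep_trace (g \@ w) by rewrite -SM Su rep_traceZ.
split=> L x y w.
  apply: level_eq_next => g; have := H _ _ g w; rewrite L compZr compZl !rep_traceZ => e.
  have n0 : b' x / b y != 0 by rewrite mulf_neq0 ?invr_eq0.
  by apply: (mulfI n0); rewrite e mulrA /b'; congr (_ * _); field; rewrite !b0 u0.
apply: step_eq_next => g; have := H _ _ w g; rewrite L compZr compZl !rep_traceZ => e.
have n0 : b' y / b' x != 0 by rewrite mulf_neq0 ?invr_eq0.
by apply: (mulfI n0); rewrite e mulrA /b'; congr (_ * _); field; rewrite !b0 !u0.
Qed.

Lemma level_next : level_scaled i b <-> level_scaled (i + 1) (fun x => u x * b x).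
Proof. exact: iff_trans level_step step_level. Qed.
Lemma level_to_step : level_scaled i b -> step_scaled i (fun x => u x * b x) b.
Proof. by move/level_step. Qed.
End Step.

(** The scalars at level i are b times the product of the scalars u of the steps from
i0 to i, inverted for steps taken downwards. *)
Lemma level_propagation (i0 : int) (b : vert A -> K) :
  (forall x, b x != 0) -> level_scaled i0 b ->
  exists2 v : Ahat -> K, forall p, v p != 0 &
    forall p q (f : hom Ahat p q), S f = (v q / v p) *: f.
Proof.
move=> b0 L0.
have /choice[u /all_and2[u0 Su]] (p : vert A * int) : exists u : K, u != 0 /\
    forall w : hom Ahat (p.1, p.2) (p.1, p.2 + 1), S w = u *: w.
  by have [k k0 kw] := socle_scalar p.1 p.2; exists k.
pose v (i : int) x := zprod (fun j => u (x, i0 + j)) (i - i0) * b x.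
have v0 i x : v i x != 0 by rewrite mulf_neq0 // zprod_neq0.
have vS i x : v (i + 1) x = u (x, i) * v i x.
  have e : i + 1 - i0 = 1 + (i - i0) by ring.
  by rewrite /v e zprodS // mulrA subKl.
have LS i : level_scaled i (v i) <-> level_scaled (i + 1) (v (i + 1)).
  have -> : v (i + 1) = (fun x => u (x, i) * v i x) by apply/funext => x.
  by apply: level_next => // x w; apply: (Su (x, i)).
have L i : level_scaled i (v i).
  rewrite -(subKl i0 i); elim/int_ind: (i - i0) => [|m IH|m IH].
  - by rewrite addr0 => x y g; rewrite /v subrr !zprod0 !mul1r; apply: L0.
  - by rewrite -addn1 PoszD addrA -LS.
  by rewrite LS -addn1 PoszD opprD addrA subrK.
exists (fun p => v p.2 p.1) => [p|[x i] [y j] f]; first exact: v0.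
have [->|/rep_hom_level[/= ji|/= ji]] := eqVneq f 0.
- by rewrite scaler0 -[0 in LHS](scale0r (0 : hom Ahat (x, i) (y, j))) SZ scale0r.
- by subst j; apply: L.
subst j; rewrite /= vS.
apply: (@level_to_step i (fun x => u (x, i)) (v i)) => //.
by move=> z w; apply: (Su (z, i)).
Qed.
End Levels.

(** * The comparison of phi and psi *)

Section Comparison.
Variables (K : fieldType) (A : basic_algebra K).
Local Notation Ahat := (repcat A).

(** Straightened, the functor maps each morphism space to itself, which is the
setting of [level_propagation]; the hypothesis compares elements of A because it
speaks of the functor before straightening. *)
Lemma level_determines (F : linfunctor Ahat Ahat) (i0 : int) (b : vert A -> K) :
  no_nonzero_oriented_cycles A ->
  (forall p, F p = p) ->
  (forall p q (f : hom Ahat p q), fmor F f = 0 -> f = 0) ->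
  (forall x, b x != 0) ->
  (forall x y (f : hom (alg_cat A) x y),
    vsval (proj_mor (fmor F (emb_mor i0 f))) = (b y / b x) *: vsval f) ->
  exists (v : Ahat -> K) (v0 : forall p, v p != 0), F = rescale (idF Ahat) v0.
Proof.
move=> hA e; rewrite (straightenE e); set G := straighten e => inj b0 base.
have [|v v0 Gv] := @level_propagation _ _ (fun p q => @fmor _ _ _ G p q)
  (fun p q k f => fmorZ G k f) (fun p q r g f => fmorM G g f) inj hA i0 b b0.
  move=> x y g; have gE : g = emb_mor i0 (proj_mor g).
    apply: rep_homP => //.
    exact: (@same_level_dual _ _ (x, i0) (y, i0) g).
  apply: rep_homP; last by rewrite !same_level_dual.
  by apply: val_inj; rewrite {1}gE; apply: base.
exists v, v0; apply/esym; apply: (@functor_eq_same_ob _ _ _ (rescale (idF Ahat) v0)).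
by move=> p q f; apply/esym/Gv.
Qed.

Lemma nakayama_pow (m : int) : apow (nakayama A) m = shift A m.
Proof.
have e p : apow (nakayama A) m p = shift A m p by rewrite nakayama_pow_ob.
have P (k : int) : compF (shift A 1) (shift A k) = shift A (1 + k).
  have e' p : compF (shift A 1) (shift A k) p = shift A (1 + k) p.
    by rewrite /= /shift_ob /= -addrA [k + 1]addrC.
  by apply: (linfunctorP (e := e')) => -[x i] [y j] f; apply: rep_eqm.
have N (k : int) : compF (shift A (-1)) (shift A k) = shift A (-1 + k).
  have e' p : compF (shift A (-1)) (shift A k) p = shift A (-1 + k) p.
    by rewrite /= /shift_ob /= -addrA [k - 1]addrC.
  by apply: (linfunctorP (e := e')) => -[x i] [y j] f; apply: rep_eqm.
elim/int_ind: m {e} => [|m IH|m IH].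
- have e' p : idF Ahat p = shift A 0 p by case: p => x i; rewrite /= /shift_ob addr0.
  by apply: (linfunctorP (e := e')) => -[x i] [y j] f; apply: rep_eqm.
- by rewrite -addn1 addnC PoszD apowS IH P.
by rewrite -addn1 addnC PoszD opprD apowP IH N.
Qed.

Lemma shift_emb (m : int) : compF (shift A m) (emb A 0) = emb A m.
Proof.
have e x : compF (shift A m) (emb A 0) x = emb A m x by rewrite /= /shift_ob add0r.
by apply: (linfunctorP (e := e)) => x y f; apply: rep_eqm.
Qed.

(** The quotient phi_0^-1 psi_0 sees phi^-1 psi on level -n, since the shift by -n is
applied before psi. *)
Lemma zero_aut_quotient (phi psi : autom Ahat) (n : int)
    (hphi : has_jump phi n) (hpsi : has_jump psi n) :
  autf (aut_comp (aut_inv (zero_aut hphi)) (zero_aut hpsi)) =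
  compF (proj A) (compF (shift A n)
    (compF (compF (autinv phi) psi) (emb A (- n)))).
Proof.
rewrite /= {1}/zero_part_inv nakayama_pow -!compFA zero_part_emb //.
by rewrite nakayama_pow shift_emb.
Qed.

Lemma fmor_vsval (F G : linfunctor (alg_cat A) (alg_cat A)) x y
    (f : hom (alg_cat A) x y) : F = G -> vsval (fmor F f) = vsval (fmor G f).
Proof. by move=> ->. Qed.

(** The functor phi^-1 psi fixes the objects, so its level -n decides that it is a
rescaling of the identity; composing with phi turns this into a statement on psi. *)
Lemma rescaled_of_zero_aut (Q : quiver (vert A)) (pi : presentation Q)
    (hA : no_nonzero_oriented_cycles A)
    (n : int) (phi psi : autom Ahat)
    (hphi : has_jump phi n) (hpsi : has_jump psi n)
    (hob : forall p : Ahat, phi p = psi p)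
    (b : vert A -> K) (b0 : forall x, b x != 0)
    (h1 : forall a : arrow Q,
       vsval (fmor (aut_comp (aut_inv (zero_aut hphi)) (zero_aut hpsi))
                   (arrow_class pi a)) =
         (b (tgt a) / b (src a)) *: vsval (arrow_class pi a)) :
  exists (v : Ahat -> K) (v0 : forall p, v p != 0), autf psi = rescale phi v0.
Proof.
set th := aut_comp _ _ in h1.
have thob x : th x = x.
  rewrite -[RHS](aut_obK (zero_aut hphi)) /=; congr (autinv (zero_aut hphi) _).
  by rewrite /= hob.
have base := path_functor_scales b0 thob h1.
have e p : compF (autinv phi) psi p = p by rewrite /= -hob aut_obK.
have inj p q (f : hom Ahat p q) : fmor (compF (autinv phi) psi) f = 0 -> f = 0.
  by move/(@aut_mor0 _ _ (aut_inv phi))/(@aut_mor0 _ _ psi).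
have [x y f|v [v0 vE]] := level_determines hA e inj b0 (i0 := - n).
  by rewrite -base (fmor_vsval _ (zero_aut_quotient hphi hpsi)).
exists v, v0; rewrite -[LHS]comp1F -(autKV phi) -compFA vE.
apply: (@functor_eq_same_ob _ _ _ (compF phi (rescale (idF Ahat) v0))) => p q f.
by rewrite /= /rescale_mor fmorZ.
Qed.
End Comparison.

Theorem theorem4p5 (K : closedFieldType) (A : basic_algebra K)
    (Q : quiver (vert A)) (pi : presentation Q)
    (hA : no_nonzero_oriented_cycles A)
    (n : int) (phi psi : autom (repcat A))
    (hphi : has_jump phi n) (hpsi : has_jump psi n)
    (hob : forall p : repcat A, phi p = psi p)
    (S : set (seq (darrow Q))) (hS : cycle_representatives S)
    (c : vert A -> vert A -> K)
    (h1 : forall (x y : vert A) (a : arrow Q), src a = x -> tgt a = y ->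
       c x y != 0 /\
       vsval (fmor (aut_comp (aut_inv (zero_aut hphi)) (zero_aut hpsi))
                   (arrow_class pi a)) =
         c x y *: vsval (arrow_class pi a))
    (h2 : forall C, S C -> walk_scalar c C = 1) :
  exists (eta : nattrans psi phi) (etaZ : equivariant psi phi),
    [/\ is_natiso eta,
        forall p : repcat A, etaZ 1 p = eta p,
        gr_equivalence (orbit_functor etaZ) &
        n != 0 -> forall P : repcat A -> Prop, orbit_transversal phi P ->
          gr_equivalence (orbit_functor_on etaZ P) /\
          gr_isomorphism (orbit_functor_on etaZ P)].
Proof.
have c0 (a : arrow Q) : c (src a) (tgt a) != 0 by have [] := h1 _ _ a erefl erefl.
have [b b0 cb] := potential_of_cycles c0 (simple_cycle_scalar hS h2).
have [a|v [v0 psiE]] := rescaled_of_zero_aut hA hob b0 (pi := pi)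
    (hphi := hphi) (hpsi := hpsi).
  by rewrite -cb; have [] := h1 _ _ a erefl erefl.
pose etaZ := scalar_equivariant psiE.
(* The first power of an automorphism unfolds to its composite with the identity,
   which is convertible to it. *)
pose eta : nattrans psi phi :=
  @NatTrans _ _ _ psi phi (fun p => etaZ 1 p) (@ntcP _ _ _ _ _ (etaZ 1)).
exists eta, etaZ; split=> //.
- by move=> p; apply: (eqv_iso etaZ 1).
- exact: orbit_functor_equivalence.
by move=> _ P _; apply: orbit_functor_on_equivalence.
Qed.
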